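(* Let $A$ and $B$ be two vector spaces over a field of characteristic $0$. Let $\mathfrak b=\bigoplus_{n\ge0}\mathfrak b_n$ with $\mathfrak b_n=\mathrm{Hom}(B^{\otimes n+1},A)$, and let $\mathscr Q$ be the graded Lie algebra defined in the context. Then $(\mathscr Q[1]\oplus\mathfrak b,\{\widetilde l_k\}_{k=1}^\infty)$ is an $L_\infty$-algebra, where $$\widetilde l_2(F[1],G[1])=(-1)^{|F|}[F,G][1],\qquad \widetilde l_k(F[1],f_1,\ldots,f_{k-1})=P[\cdots[[F,f_1],f_2],\ldots,f_{k-1}],\quad k\ge2,$$ for all homogeneous $F,G\in\mathscr Q$ and $f_1,\ldots,f_{k-1}\in\mathfrak b$, and, up to permutation of the entries (by graded symmetry), all other components of the maps $\widetilde l_k$ vanish (in particular $\widetilde l_1=0$).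
   Context: Let $\mathfrak g=\bigoplus_{n\ge0}\mathfrak g_n$, $\mathfrak g_n=\mathrm{Hom}((A\oplus B)^{\otimes n+1},A\oplus B)$, be the graded Lie algebra with the Gerstenhaber bracket: for $f$ with $m$ inputs and $g$ with $n$ inputs, $[f,g]=f\diamond g-(-1)^{(m-1)(n-1)}g\diamond f$, where $(f\diamond g)(v_1,\ldots,v_{m+n-1})=\sum_{i=1}^m(-1)^{(i-1)(n-1)}f(v_1,\ldots,v_{i-1},g(v_i,\ldots,v_{i+n-1}),v_{i+n},\ldots,v_{m+n-1})$. Maps $B^{\otimes n+1}\to A$ are regarded as elements of $\mathfrak g_n$ by extending them by zero, so $\mathfrak b\subset\mathfrak g$; $P:\mathfrak g\to\mathfrak b$ is the projection, i.e. for $F\in\mathfrak g_n$, $P(F)$ is the $A$-component of $F|_{B^{\otimes n+1}}$. Let $\mathcal A^{k,l}$ be the direct sum of all $(k+l)$-fold tensor products of $A$'s and $B$'s in which $A$ appears $k$ times and $B$ appears $l$ times. For $k,l\ge-1$ with $k+l=n$, $C^{k|l}\subset\mathfrak g_n$ is the space of maps $f$ with $f(\mathcal A^{k+1,l})\subset A$, $f(\mathcal A^{k,l+1})\subset B$ and $f=0$ on all other components. Put $\mathscr Q_n=C^{n+1|-1}\oplus C^{n|0}\oplus\cdots\oplus C^{0|n}\subset\mathfrak g_n$; $\mathscr Q=\bigoplus_{n\ge0}\mathscr Q_n$ is a graded Lie subalgebra of $\mathfrak g$. The degree shift is $(\mathscr Q[1])_n=\mathscr Q_{n+1}$; $F\in\mathscr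 Q$ viewed in $\mathscr Q[1]$ is written $F[1]$, and $|F|$ is the degree of $F$ in $\mathscr Q$ (so $|F|=n$ if $F\in\mathscr Q_n$). An $L_\infty$-algebra is a graded vector space $\mathcal G$ with graded symmetric (with Koszul sign $\epsilon(\sigma)$) degree $1$ maps $l_k:\mathcal G^{\otimes k}\to\mathcal G$, $k\ge1$, such that for all $N\ge1$ and homogeneous $x_1,\ldots,x_N$: $\sum_{i=1}^N\sum_{\sigma\in Sh(i,N-i)}\epsilon(\sigma)\,l_{N-i+1}(l_i(x_{\sigma(1)},\ldots,x_{\sigma(i)}),x_{\sigma(i+1)},\ldots,x_{\sigma(N)})=0$, where $Sh(i,N-i)$ is the set of $(i,N-i)$-shuffles. *)

(* Defs.v *)
From HB Require Import structures.
From mathcomp Require Import all_boot all_order all_algebra all_fingroup.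
From mathcomp Require Import boolp classical_sets functions.

Set Implicit Arguments.
Unset Strict Implicit.
Unset Printing Implicit Defensive.

Import GRing.Theory.
Local Open Scope ring_scope.

(* A family of maps (f_k : U^k -> W multilinear)_k is encoded as one function
   f : seq U -> W, with f_k the restriction of f to lists of length k. *)
Section Multilinear.
Variables (K : fieldType) (U W : lmodType K).

Definition multilinear (f : seq U -> W) : Prop :=
  forall (s t : seq U) (a : K) (u v : U),
    f (s ++ (a *: u + v) :: t) = a *: f (s ++ u :: t) + f (s ++ v :: t).

(* multilinear maps U^{n+1} -> W *)
Definition Homn (n : nat) (f : seq U -> W) : Prop :=
  multilinear f /\ forall s, size s != n.+1 -> f s = 0.

End Multilinear.

Section Graded.
Variables (K : fieldType) (W : lmodType K).

Definition is_subspace (H : W -> Prop) : Prop :=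
  H 0 /\ forall (a : K) (x y : W), H x -> H y -> H (a *: x + y).

Definition sum_of (H : nat -> W -> Prop) (x : W) : Prop :=
  exists N (y : nat -> W), (forall n, H n (y n)) /\ x = \sum_(n < N) y n.

Lemma sum_of_submod (H : nat -> W -> Prop) :
  (forall n, is_subspace (H n)) -> is_subspace (sum_of H).
Proof.
move=> sH; split=> [|a x y [N [u [Hu ->]]] [M [v [Hv ->]]]].
  by exists 0, (fun=> 0); split=> [n|]; [case: (sH n) | rewrite big_ord0].
have widen (P : nat) (z : nat -> W) : (P <= N + M)%N ->
    \sum_(n < P) z n = \sum_(n < N + M) (if (n < P)%N then z n else 0).
  by move=> leP; rewrite (big_ord_widen _ z leP) big_mkcond.
exists (N + M)%N, (fun n => a *: (if (n < N)%N then u n else 0)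
                          + (if (n < M)%N then v n else 0)).
split=> [n|].
  have [H0 HD] := sH n.
  by apply: HD; case: ifP.
rewrite (widen N) ?leq_addr // (widen M) ?leq_addl //.
by rewrite big_split scaler_sumr.
Qed.

(* gr d is the degree d part; W is the internal direct sum of the gr d. *)
Definition is_grading (gr : int -> W -> Prop) : Prop :=
  [/\ forall d, is_subspace (gr d),
      forall x, exists (ds : seq int) (y : int -> W),
        (forall d, gr d (y d)) /\ x = \sum_(d <- ds) y d
    & forall (ds : seq int) (y : int -> W), uniq ds ->
        (forall d, gr d (y d)) -> \sum_(d <- ds) y d = 0 ->
        forall d, d \in ds -> y d = 0].

(* The sign with x_1 ... x_N = koszul d sigma * x_(sigma 1) ... x_(sigma N)
   in the graded symmetric algebra, for x_i of degree d i. *)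
Definition koszul N (d : 'I_N -> int) (sigma : 'S_N) : K :=
  \prod_(i < N) \prod_(j < N | (i < j)%N && (sigma j < sigma i)%N)
     (-1) ^ (d (sigma i) * d (sigma j)).

Definition permuted N (x : 'I_N -> W) (sigma : 'S_N) : seq W :=
  [seq x (sigma i) | i <- enum 'I_N].

Definition is_shuffle N (i : nat) (sigma : 'S_N) : bool :=
  [forall a : 'I_N, forall b : 'I_N,
     (a < b)%N && ((b < i)%N || (i <= a)%N) ==> (sigma a < sigma b)%N].

Definition graded_symmetric (gr : int -> W -> Prop) (l : seq W -> W) : Prop :=
  forall N (x : 'I_N -> W) (d : 'I_N -> int) (sigma : 'S_N),
    (forall i, gr (d i) (x i)) ->
    l (permuted x 1%g) = koszul d sigma *: l (permuted x sigma).

(* l_k is the restriction of l to lists of length k; l [::] is irrelevant. *)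
Record Linfty_algebra (gr : int -> W -> Prop) (l : seq W -> W) : Prop := {
  Linfty_grading : is_grading gr;
  Linfty_multilinear : multilinear l;
  Linfty_symmetric : graded_symmetric gr l;
  Linfty_degree : forall N (x : 'I_N -> W) (d : 'I_N -> int), (0 < N)%N ->
    (forall i, gr (d i) (x i)) ->
    gr (\sum_(i < N) d i + 1) (l (permuted x 1%g));
  Linfty_jacobi : forall N (x : 'I_N -> W) (d : 'I_N -> int), (0 < N)%N ->
    (forall i, gr (d i) (x i)) ->
    \sum_(1 <= i < N.+1) \sum_(sigma : 'S_N | is_shuffle i sigma)
      koszul d sigma *:
        l (l (take i (permuted x sigma)) :: drop i (permuted x sigma)) = 0
}.

End Graded.

(* An element of the direct sum of the g_n is a function F : seq V -> V whose
   component of degree n is its restriction to lists of length n+1. *)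
Section Gerstenhaber.
Variables (K : fieldType) (V : lmodType K).

(* f <> g for f of degree p and g of degree q, i.e. with p+1 and q+1 inputs,
   on a list of length p+q+1. *)
Definition diamond (p q : nat) (f g : seq V -> V) (vs : seq V) : V :=
  \sum_(i < p.+1) (-1) ^+ (i * q) *:
    f (take i vs ++ g (take q.+1 (drop i vs)) :: drop (i + q.+1) vs).

(* Bilinear extension to non-homogeneous f, g: on a list of length n+1 only the
   pairs of degrees p + q = n contribute, and the lengths of the lists to which
   diamond p q applies f and g select their components of degrees p and q. *)
Definition bracket (f g : seq V -> V) : seq V -> V := fun vs =>
  \sum_(p < size vs) let q := (size vs - p.+1)%N in
    (diamond p q f g vs - (-1) ^+ (p * q) *: diamond q p g f vs).

End Gerstenhaber.

Section QB.
Variables (K : fieldType) (A B : lmodType K).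

Definition inA (v : A * B) : bool := v.2 == 0.
Definition inB (v : A * B) : bool := v.1 == 0.

(* Decomposable tensors of the direct sum of the tensor products of k copies
   of A and l copies of B; w records a tensor product, true standing for A. *)
Definition calA (k l : int) (vs : seq (A * B)) : Prop :=
  exists w : seq bool,
    [/\ (count_mem true w)%:Z = k, (count_mem false w)%:Z = l
      & all2 (fun a v => if a then inA v else inB v) w vs].

(* C^{k|l}, a subspace of g_n with n = k + l *)
Definition Ckl (n : nat) (k l : int) (f : seq (A * B) -> A * B) : Prop :=
  [/\ k + l = n%:Z /\ Homn n f,
      forall vs, calA (k + 1) l vs -> inA (f vs),
      forall vs, calA k (l + 1) vs -> inB (f vs)
    & forall p q vs, (p, q) != (k + 1, l) -> (p, q) != (k, l + 1) ->
        calA p q vs -> f vs = 0].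

(* C^{n+1|-1} + C^{n|0} + ... + C^{0|n} *)
Definition Qn (n : nat) (F : seq (A * B) -> A * B) : Prop :=
  exists f : 'I_n.+2 -> (seq (A * B) -> A * B),
    (forall i : 'I_n.+2, Ckl n (n%:Z + 1 - i%:Z) (i%:Z - 1) (f i)) /\
    F = \sum_i f i.

Lemma Homn_submod (U W : lmodType K) n : is_subspace (@Homn K U W n).
Proof.
split=> [|a f g [mf sf] [mg sg]].
  by split=> // s t a u v; rewrite scaler0 addr0.
split=> [s t b u v|s ns].
  rewrite !fctE mf mg !scalerDr !scalerA [in RHS]addrACA.
  by rewrite [b * a]mulrC.
by rewrite !fctE (sf _ ns) (sg _ ns) scaler0 addr0.
Qed.

Lemma Ckl_submod n k l : k + l = n%:Z -> is_subspace (@Ckl n k l).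
Proof.
move=> kl; have [H0 HD] := @Homn_submod (A * B)%type (A * B)%type n.
split=> [|a f g [[_ hf] fA fB f0] [[_ hg] gA gB g0]].
  by split=> // vs _; rewrite /inA /inB.
split=> [|vs vsA|vs vsB|p q vs n1 n2 vspq].
- by split=> //; apply: HD.
- by rewrite /inA /= (eqP (fA _ vsA)) (eqP (gA _ vsA)) scaler0 addr0.
- by rewrite /inB /= (eqP (fB _ vsB)) (eqP (gB _ vsB)) scaler0 addr0.
- by rewrite !fctE (f0 p q) // (g0 p q) // scaler0 addr0.
Qed.

Lemma Qn_submod n : is_subspace (@Qn n).
Proof.
have kl (i : 'I_n.+2) : (n%:Z + 1 - i%:Z) + (i%:Z - 1) = n%:Z.
  by rewrite addrA subrK addrK.
split=> [|a F G [f [Hf ->]] [g [Hg ->]]].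
  by exists (fun=> 0); split=> [i|]; [case: (Ckl_submod (kl i)) | rewrite big1].
exists (fun i => a *: f i + g i); split=> [i|].
  by have [_ HD] := Ckl_submod (kl i); apply: HD.
by rewrite big_split scaler_sumr.
Qed.

Definition Q_pred : {pred seq (A * B) -> A * B} := fun F => `[< sum_of Qn F >].
Definition b_pred : {pred seq B -> A} := fun f => `[< sum_of (@Homn K B A) f >].

Fact Q_pred_closed : submod_closed Q_pred.
Proof.
have [H0 HD] := sum_of_submod Qn_submod.
split=> [|a F G /asboolP HF /asboolP HG]; apply/asboolP => //.
exact: HD.
Qed.

Fact b_pred_closed : submod_closed b_pred.
Proof.
have [H0 HD] := sum_of_submod (@Homn_submod B A).
split=> [|a F G /asboolP HF /asboolP HG]; apply/asboolP => //.
exact: HD.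
Qed.

HB.instance Definition _ :=
  GRing.isSubmodClosed.Build K (seq (A * B) -> A * B) Q_pred Q_pred_closed.
HB.instance Definition _ :=
  GRing.isSubmodClosed.Build K (seq B -> A) b_pred b_pred_closed.

Record Q : Type := MkQ { Qval :> seq (A * B) -> A * B; _ : Qval \in Q_pred }.
HB.instance Definition _ := [isSub for Qval].
HB.instance Definition _ := [Choice of Q by <:].
HB.instance Definition _ := [SubChoice_isSubLmodule of Q by <:].

Record b : Type := Mkb { bval :> seq B -> A; _ : bval \in b_pred }.
HB.instance Definition _ := [isSub for bval].
HB.instance Definition _ := [Choice of b by <:].
HB.instance Definition _ := [SubChoice_isSubLmodule of b by <:].

(* Q[1] + b *)
Definition QB : lmodType K := (Q * b)%type.

Definition deg_Q (d : int) (F : Q) : Prop :=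
  if d is Posz n then Qn n F else F = 0.
Definition deg_b (d : int) (f : b) : Prop :=
  if d is Posz n then Homn n f else f = 0.
Definition deg_QB (d : int) (x : QB) : Prop :=
  deg_Q (d + 1) x.1 /\ deg_b d x.2.

Definition in1 (F : Q) : QB := (F, 0).
Definition in2 (f : b) : QB := (0, f).

Definition ext0 (f : seq B -> A) : seq (A * B) -> A * B :=
  fun vs => (f [seq v.2 | v <- vs], 0).

Definition P (F : seq (A * B) -> A * B) : seq B -> A :=
  fun bs => (F [seq (0, y) | y <- bs]).1.

(* [...[[F, f_1], f_2], ..., f_m] *)
Definition iter_bracket (F : Q) (fs : seq b) : seq (A * B) -> A * B :=
  foldl (fun G (f : b) => bracket G (ext0 f)) F fs.

(* The description of the maps ltilde_k, k >= 1; l [::] is irrelevant. *)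
Record is_ltilde (l : seq QB -> QB) : Prop := {
  ltilde_multilinear : multilinear l;
  ltilde_symmetric : graded_symmetric deg_QB l;
  ltilde_QQ : forall (n m : nat) (F G : Q), deg_Q n F -> deg_Q m G ->
    (l [:: in1 F; in1 G]).1 = (-1) ^+ n *: bracket F G :> (seq (A * B) -> A * B)
    /\ (l [:: in1 F; in1 G]).2 = 0;
  ltilde_Qb : forall (n : nat) (F : Q) (fs : seq b), deg_Q n F ->
    (0 < size fs)%N ->
    (l (in1 F :: [seq in2 f | f <- fs])).1 = 0
    /\ (l (in1 F :: [seq in2 f | f <- fs])).2
         = P (iter_bracket F fs) :> (seq B -> A);
  ltilde_0 : forall ts : seq (Q + b),
    let nQ := count (fun t => if t is inl _ then true else false) ts in
    (0 < size ts)%N ->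
    ~~ ((nQ == 2) && (size ts == 2)) -> ~~ ((nQ == 1) && (1 < size ts)%N) ->
    l [seq match t with inl F => in1 F | inr f => in2 f end | t <- ts] = 0
}.

End QB.

(* Main.v *)
From HB Require Import structures.
From mathcomp Require Import all_boot all_order all_algebra all_fingroup.
From mathcomp Require Import boolp functions.
From mathcomp Require Import ring zify.
Require Import Defs.

Set Implicit Arguments.
Unset Strict Implicit.
Unset Printing Implicit Defensive.

Import GRing.Theory.
Local Open Scope ring_scope.

(** The argument is that of Voronov's higher derived brackets, made explicit for
    the Gerstenhaber bracket.

    The starting point is that Q is the kernel of P: the only bidegree that is
    missing in its definition is the one of maps from tensors of B to A ([QnE],
    [Q_predP]). Thus the graded Lie algebra of all multilinear maps is the sum
    of two subalgebras, the kernel Q of P and b, and b is abelian. This gives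
    P [X, Y] = P [P X, Y] + P [X, P Y] for all X and Y ([P_bracket_split]).

    The graded Jacobi identity ([bracket_jacobi]) comes from the operators
    [ins] that insert a map into another one in all positions: the graded
    commutator of the insertions of g and of h is the insertion of [g, h]
    ([ins_commutator]), because terms in which g and h occupy disjoint sets of
    arguments cancel.

    Graded symmetry of the brackets amounts to invariance, up to sign, under
    adjacent transpositions ([graded_symmetric_swap], [swap_graded_symmetric]),
    and the sum over shuffles in the generalized Jacobi identity amounts to a
    recursively defined sum [unshuffle] over all ways of splitting a list into
    two sublists ([shuffle_sumE]). By additivity and symmetry the identity is
    only needed for lists F_1, ..., F_k, f_1, ..., f_m with F_i in Q and f_j in
    b ([pure_sorted_ind]). A nonzero bracket has either one entry in Q and
    others in b, or exactly two entries, both in Q; hence all terms vanish unless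
    k = 2, or k = 3 and m = 0 ([unshuffle_vanish]). The second case is the Jacobi
    identity in Q ([jacobiator_QQQ]). In the first one the Leibniz rule ([itb_bracket])
    expands [...[[F, G], f_1], ..., f_m] into brackets [X, Y] of iterated
    brackets X of F and Y of G with complementary sublists of f_1, ..., f_m, and
    the two halves of P [X, Y] = P [P X, Y] + P [X, P Y] cancel against the
    terms in which G, respectively F, belongs to the outer bracket
    ([jacobiator_QQ]).

    For the existence of the brackets ([ltilde]) the signs in their definition
    have to be given for elements that are not homogeneous. They only depend on
    the parities of the degrees, so splitting maps into their parts of even and
    of odd degree is enough ([derived_bracket]). *)

(** * Linear identities in modules *)

Section LinearExpressions.
Variables (K : comNzRingType) (M : lmodType K).

(** Formal linear combinations of the entries of an environment. *)
Inductive lexp : Type :=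
  | LVar of nat | LZero | LAdd of lexp & lexp | LOpp of lexp
  | LScale of K & lexp.

Fixpoint leval (env : seq M) (e : lexp) : M :=
  match e with
  | LVar i => env`_i
  | LZero => 0
  | LAdd e1 e2 => leval env e1 + leval env e2
  | LOpp e1 => - leval env e1
  | LScale c e1 => c *: leval env e1
  end.

(** The coefficient of the i-th variable. *)
Fixpoint lcoef (i : nat) (e : lexp) : K :=
  match e with
  | LVar j => if eqn i j then 1 else 0
  | LZero => 0
  | LAdd e1 e2 => lcoef i e1 + lcoef i e2
  | LOpp e1 => - lcoef i e1
  | LScale c e1 => c * lcoef i e1
  end.

(** Equality of the coefficients of the first n variables. *)
Fixpoint lagree (n : nat) (e1 e2 : lexp) : Prop :=
  if n is n'.+1 then lcoef n' e1 = lcoef n' e2 /\ lagree n' e1 e2 else True.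

Lemma lagreeP n e1 e2 : lagree n e1 e2 ->
  forall i, (i < n)%N -> lcoef i e1 = lcoef i e2.
Proof.
elim: n => //= n IHn [en /IHn IH] i; rewrite ltnS leq_eqVlt.
by case/orP=> [/eqP->|/IH].
Qed.

Lemma levalE env e :
  leval env e = \sum_(i < size env) lcoef i e *: env`_i.
Proof.
elim: e => [j||e1 IH1 e2 IH2|e1 IH1|c e1 IH1] /=.
- have [lej|ltj] := leqP (size env) j.
    rewrite nth_default // big1 // => i _.
    case: eqnP => [ij|_]; last by rewrite scale0r.
    by rewrite -ij leqNgt ltn_ord in lej.
  rewrite (bigD1 (Ordinal ltj)) //= (introT eqnP erefl) scale1r big1 ?addr0 // => i.
  by case: eqnP => [ij /eqP[]|]; rewrite ?scale0r //; apply: val_inj.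
- by rewrite big1 // => i _; rewrite scale0r.
- by rewrite IH1 IH2 -big_split; apply: eq_bigr => i _; rewrite scalerDl.
- by rewrite IH1 -sumrN; apply: eq_bigr => i _; rewrite scaleNr.
- by rewrite IH1 scaler_sumr; apply: eq_bigr => i _; rewrite scalerA.
Qed.

Lemma leval_eq env e1 e2 :
  lagree (size env) e1 e2 -> leval env e1 = leval env e2.
Proof.
by move=> /lagreeP H; rewrite !levalE; apply: eq_bigr => i _; rewrite H.
Qed.

End LinearExpressions.

Arguments LVar {K} _.
Arguments LZero {K}.

(** Reification of a module element; cmp is the test that decides whether two
    atoms are the same. *)
Ltac lin_find cmp a l :=
  lazymatch l with
  | ?x :: ?l' =>
      let b := match constr:(Set) with
               | _ => let _ := match constr:(Set) with _ => cmp a x end in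
                      constr:(true)
               | _ => constr:(false)
               end in
      lazymatch b with
      | true => constr:(O)
      | false => let n := lin_find cmp a l' in constr:(S n)
      end
  end.

Ltac lin_mem cmp a l :=
  lazymatch l with
  | nil => constr:(false)
  | ?x :: ?l' =>
      match constr:(Set) with
      | _ => let _ := match constr:(Set) with _ => cmp a x end in
             constr:(true)
      | _ => lin_mem cmp a l'
      end
  end.

Ltac lin_atoms cmp t l :=
  lazymatch t with
  | @GRing.add _ ?a ?b => let l1 := lin_atoms cmp a l in lin_atoms cmp b l1
  | @GRing.opp _ ?a => lin_atoms cmp a l
  | @GRing.scale _ _ _ ?a => lin_atoms cmp a l
  | @GRing.zero _ => l
  | _ => let b := lin_mem cmp t l in
         lazymatch b with true => l | false => constr:(t :: l) end
  end.

Ltac lin_reify cmp K t l :=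
  lazymatch t with
  | @GRing.add _ ?a ?b =>
      let ea := lin_reify cmp K a l in let eb := lin_reify cmp K b l in
      constr:(LAdd ea eb)
  | @GRing.opp _ ?a => let ea := lin_reify cmp K a l in constr:(LOpp ea)
  | @GRing.scale _ _ ?c ?a => let ea := lin_reify cmp K a l in constr:(LScale c ea)
  | @GRing.zero _ => constr:(@LZero K)
  | _ => let i := lin_find cmp t l in constr:(@LVar K i)
  end.

(** Reduces an equality in a K-module to the equality of the coefficients of
    its two sides in the module elements occurring in them. *)
Ltac lin_coefs cmp K M :=
  lazymatch goal with
  | |- @eq _ ?t1 ?t2 =>
      let l0 := lin_atoms cmp t1 (@nil (GRing.Lmodule.sort M)) in
      let l := lin_atoms cmp t2 l0 in
      let e1 := lin_reify cmp K t1 l in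
      let e2 := lin_reify cmp K t2 l in
      apply: (@leval_eq K M l e1 e2); cbn -[GRing.add GRing.mul GRing.opp
        GRing.zero GRing.one GRing.exp]; repeat split
  end.

(** Module identities whose coefficients agree by ring computations; the second
    tactic identifies convertible atoms. *)
Ltac lin_ring K M := lin_coefs ltac:(fun a x => constr_eq a x) K M; ring.
Ltac lin_ring_conv K M := lin_coefs ltac:(fun a x => unify a x) K M; ring.

(** Splits a goal on the parities of the exponents of its signs. *)
Ltac sign_cases :=
  repeat match goal with
  | |- context [@GRing.exp ?R (- 1) ?n] =>
      lazymatch n with
      | nat_of_bool _ => fail
      | _ => rewrite -(@signr_odd R n)
      end
  end;
  rewrite ?(oddD, oddM, oddS);
  repeat match goal with |- context [odd ?n] => case: (odd n) end;
  rewrite /= ?(expr0, expr1).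

(** * Multilinear maps on lists *)

Lemma fctcombE (K : fieldType) (T : Type) (W : lmodType K) (a : K)
    (f g : T -> W) x :
  (a *: f + g) x = a *: f x + g x.
Proof. by []. Qed.

Section MultilinearTheory.
Variables (K : fieldType) (U W : lmodType K).
Implicit Types (f g : seq U -> W) (s t : seq U).

Lemma multilinearD f s t u v : multilinear f ->
  f (s ++ (u + v) :: t) = f (s ++ u :: t) + f (s ++ v :: t).
Proof. by move=> fL; rewrite -[u]scale1r fL !scale1r. Qed.

Lemma multilinear0 f s t : multilinear f -> f (s ++ 0 :: t) = 0.
Proof.
move=> fL; have := multilinearD s t 0 0 fL; rewrite addr0.
by move=> /esym/eqP; rewrite -subr_eq0 addrK => /eqP.
Qed.

Lemma multilinearZ f s t a u : multilinear f ->
  f (s ++ (a *: u) :: t) = a *: f (s ++ u :: t).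
Proof. by move=> fL; rewrite -[a *: u]addr0 fL multilinear0 ?addr0. Qed.

Lemma multilinear_cat f s : multilinear f -> multilinear (fun t => f (s ++ t)).
Proof. by move=> fL s' t a u v; rewrite !catA fL. Qed.

Lemma multilinear_comb f g (a : K) : multilinear f -> multilinear g ->
  multilinear (a *: f + g).
Proof.
move=> fL gL s t c u v; rewrite !fctE fL gL.
lin_ring K W.
Qed.

Lemma multilinear_scale f (a : K) : multilinear f -> multilinear (a *: f).
Proof.
move=> fL; rewrite -[a *: f]addr0; apply: multilinear_comb => // s t c u v.
by rewrite scaler0 addr0.
Qed.

End MultilinearTheory.

(** * Insertion operators and the Gerstenhaber bracket *)

Section Insertion.
Variables (K : fieldType) (U : lmodType K).

(** The sum of all insertions of the map g, taken with r + 1 inputs, into Phi: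
    the term with i arguments before g carries the sign (-1)^(i r). Recursion
    on the list of arguments separates the insertion in front from the
    others. *)
Fixpoint ins (W : lmodType K) (r : nat) (g : seq U -> U) (Phi : seq U -> W)
    (vs : seq U) : W :=
  if vs is v :: vs' then
    (if (r <= size vs')%N then Phi (g (v :: take r vs') :: drop r vs') else 0)
    + (-1) ^+ r *: ins r g (fun ws => Phi (v :: ws)) vs'
  else 0.

Section Target.
Variable W : lmodType K.
Implicit Types (Phi Psi : seq U -> W) (g h : seq U -> U) (vs : seq U).

Lemma insE r g Phi vs : ins r g Phi vs =
  \sum_(i < size vs - r) (-1) ^+ (i * r) *:
     Phi (take i vs ++ g (take r.+1 (drop i vs)) :: drop (i + r.+1) vs).
Proof.
elim: vs Phi => [|v vs IH] Phi /=; first by rewrite big_ord0.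
case: leqP => [lerv|ltvr]; last first.
  have /eqP-> : ((size vs).+1 - r == 0)%N by rewrite subn_eq0.
  rewrite big_ord0 IH; have /eqP-> : (size vs - r == 0)%N by rewrite subn_eq0 ltnW.
  by rewrite big_ord0 scaler0 addr0.
rewrite subSn // big_ord_recl /= ?mul0n ?expr0 ?scale1r; congr (_ + _).
rewrite IH scaler_sumr; apply: eq_bigr => i _ /=.
by rewrite scalerA -exprD /bump /= add1n mulSn.
Qed.

Lemma eq_ins r g Phi Psi vs : Phi =1 Psi -> ins r g Phi vs = ins r g Psi vs.
Proof. by move=> eqP; rewrite !insE; apply: eq_bigr => i _; rewrite eqP. Qed.


Arguments eq_ins {r g Phi} Psi {vs}.

Lemma ins_linear r g a Phi Psi vs :
  ins r g (fun ws => a *: Phi ws + Psi ws) vs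
    = a *: ins r g Phi vs + ins r g Psi vs.
Proof.
elim: vs Phi Psi => [|v vs IH] Phi Psi /=; first by rewrite scaler0 addr0.
rewrite IH; case: ifP => _; lin_ring K W.
Qed.

Lemma ins_fctE r g a Phi Psi :
  ins r g (a *: Phi + Psi) = a *: ins r g Phi + ins r g Psi.
Proof. by apply: funext => vs; exact: ins_linear. Qed.

Lemma ins0 r g vs : ins r g (fun=> 0 : W) vs = 0.
Proof. by rewrite insE big1 // => i _; rewrite scaler0. Qed.

(** Linearity in the inserted map requires linearity of the outer one. *)
Lemma ins_linearl r a g h Phi vs : multilinear Phi ->
  ins r (a *: g + h) Phi vs = a *: ins r g Phi vs + ins r h Phi vs.
Proof.
elim: vs Phi => [|v vs IH] Phi PhiL /=; first by rewrite scaler0 addr0.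
rewrite IH; last exact: (multilinear_cat [:: v]).
case: ifP => _; last by lin_ring K W.
rewrite fctcombE (PhiL [::]) /=.
lin_ring K W.
Qed.

Lemma ins_short r g Phi vs : (size vs <= r)%N -> ins r g Phi vs = 0.
Proof. by move=> le; rewrite insE (eqP (_ : size vs - r == 0)%N) ?subn_eq0 ?big_ord0. Qed.

Lemma ins_multilinear r g Phi :
  multilinear g -> multilinear Phi -> multilinear (ins r g Phi).
Proof.
move=> gL PhiL s; elim: s Phi PhiL => [|x s IH] Phi PhiL t a u v /=.
  rewrite (eq_ins (fun ws => a *: Phi (u :: ws) + Phi (v :: ws))).
    rewrite ins_linear; case: ifP => _; last by lin_ring K W.
    by rewrite (gL [::]) (PhiL [::]) /=; lin_ring K W.
  by move=> ws; apply: (PhiL [::]).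
rewrite IH; last exact: (multilinear_cat [:: x]).
rewrite !size_cat /=; case: ifP => _; last by lin_ring K W.
rewrite !take_cat !drop_cat; case: ltnP => [lt_rs|le_sr].
  rewrite -!cat_cons (multilinear_cat [:: g (x :: take r s)] PhiL) /=.
  lin_ring K W.
case: (r - size s)%N => [|k] /=.
  rewrite cats0 (PhiL [:: g (x :: s)]) /=; lin_ring K W.
rewrite -!cat_cons gL (PhiL [::]) /=; lin_ring K W.
Qed.

Lemma insZ r g a Phi vs : ins r g (fun ws => a *: Phi ws) vs = a *: ins r g Phi vs.
Proof.
have := ins_linear r g a Phi (fun=> 0) vs; rewrite ins0 addr0 => <-.
by apply: eq_ins => ws; rewrite addr0.
Qed.

Lemma insD r g Phi Psi vs :
  ins r g (fun ws => Phi ws + Psi ws) vs = ins r g Phi vs + ins r g Psi vs.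
Proof.
rewrite -[ins r g Phi vs]scale1r -ins_linear.
by apply: eq_ins => ws; rewrite scale1r.
Qed.

(** Insertion into a map that treats its first q arguments and the others
    separately: the insertion takes place either among the first ones, which then
    come from the first q + r entries of the list, or among the others. *)
Lemma ins_split q r h (Theta : seq U -> seq U -> W) vs :
  ins r h (fun ws => if (q <= size ws)%N then Theta (take q ws) (drop q ws)
                     else 0) vs
  = (if (q + r <= size vs)%N then
       ins r h (fun a => Theta a (drop (q + r) vs)) (take (q + r) vs)
     else 0)
  + (if (q <= size vs)%N then
       (-1) ^+ (q * r) *: ins r h (Theta (take q vs)) (drop q vs)
     else 0).
Proof.
elim: q vs Theta => [|q IH] vs Theta.
  rewrite mul0n scale1r add0n !leq0n drop0 take0.
  rewrite (eq_ins (Theta [::])); last by move=> ws /=; rewrite take0 drop0.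
  case: ifP => _; rewrite ?add0r // [X in X + _]ins_short ?add0r //.
  by rewrite size_take; case: ltnP.
case: vs => [|v vs] /=; first by rewrite addr0.
rewrite (eq_ins (fun ws => if (q <= size ws)%N then
   Theta (v :: take q ws) (drop q ws) else 0)) //.
rewrite (IH vs (fun a => Theta (v :: a))) size_drop addSn !ltnS mulSn exprD.
case: (leqP (q + r) (size vs)) => [le_qr|lt_qr].
  have le_r : (r <= size vs)%N by apply: leq_trans le_qr; apply: leq_addl.
  have le_q : (q <= size vs)%N by apply: leq_trans le_qr; apply: leq_addr.
  rewrite le_r le_q leq_subRL // addnC le_qr size_takel // leq_addl.
  rewrite !drop_drop take_takel ?leq_addl // take_drop.
  lin_ring K W.
rewrite add0r; case: leqP => [le_r|_]; last first.
  rewrite add0r; case: ifP => _; lin_ring K W.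
rewrite leq_subRL // [(r + q)%N]addnC leqNgt lt_qr /=.
case: ifP => _; lin_ring K W.
Qed.

End Target.
End Insertion.

Arguments eq_ins {K U W r g Phi} Psi {vs}.

Section Commutation.
Variables (K : fieldType) (U W : lmodType K).
Implicit Types (Phi : seq U -> W) (g h : seq U -> U) (vs : seq U).

Lemma ins_comp r h (L : U -> W) g vs :
  (forall a u v, L (a *: u + v) = a *: L u + L v) ->
  ins r h (fun ws => L (g ws)) vs = L (ins r h g vs).
Proof.
move=> LL.
have L0 : L 0 = 0.
  by have := LL (-1) 0 0; rewrite scaler0 addr0 scaleN1r addNr.
elim: vs g => //= v vs IH g.
rewrite IH addrC [in RHS]addrC LL; congr (_ + _).
by case: ifP.
Qed.

(** Two successive insertions: h inside g, h before g, or h after g, these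
    last two with the front argument used; or both beyond the front argument. *)
Lemma ins_ins_cons q r g h Phi v vs : multilinear Phi ->
  ins r h (ins q g Phi) (v :: vs)
  = (if (q + r <= size vs)%N then
       Phi (ins r h g (v :: take (q + r) vs) :: drop (q + r) vs) else 0)
    + (if (r <= size vs)%N then
         (-1) ^+ q *: ins q g (fun ws => Phi (h (v :: take r vs) :: ws))
           (drop r vs) else 0)
    + (if (q <= size vs)%N then
         (-1) ^+ (r + q * r) *: ins r h (fun ws => Phi (g (v :: take q vs) :: ws))
           (drop q vs) else 0)
    + (-1) ^+ (q + r) *: ins r h (ins q g (fun ws => Phi (v :: ws))) vs.
Proof.
move=> PhiL; rewrite /= insD insZ.
rewrite (ins_split q r h (fun a w => Phi (g (v :: a) :: w))).
rewrite /= (@ins_comp r h (fun u => Phi (u :: drop (q + r) vs))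
   (fun a => g (v :: a))); last by move=> a u u'; apply: (PhiL [::]).
rewrite size_drop.
case: (leqP (q + r) (size vs)) => [le_qr|lt_qr].
  have le_r : (r <= size vs)%N by apply: leq_trans le_qr; apply: leq_addl.
  have le_q : (q <= size vs)%N by apply: leq_trans le_qr; apply: leq_addr.
  rewrite le_r le_q leq_subRL // addnC le_qr size_takel // leq_addl.
  rewrite (multilinearD [::]) // (multilinearZ [::]) // /=.
  rewrite take_takel ?leq_addl // take_drop drop_drop.
  by sign_cases; lin_ring K W.
rewrite !add0r; case: leqP => [le_r|_]; last first.
  by case: ifP => _; sign_cases; lin_ring K W.
rewrite leq_subRL // [(r + q)%N]addnC leqNgt lt_qr /=.
case: ifP => _; sign_cases; lin_ring K W.
Qed.

(** The operators Phi |-> ins q g Phi represent the Gerstenhaber bracket: their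
    graded commutator is the insertion of the commutator of g and h. Terms in
    which g and h occupy disjoint sets of arguments cancel. *)
Lemma ins_commutator q r g h Phi vs : multilinear Phi ->
  ins r h (ins q g Phi) vs - (-1) ^+ (q * r) *: ins q g (ins r h Phi) vs
  = ins (q + r) (ins r h g) Phi vs
    - (-1) ^+ (q * r) *: ins (q + r) (ins q g h) Phi vs.
Proof.
elim: vs Phi => [|v vs IH] Phi PhiL; first by rewrite /= !(scaler0, subr0).
have PhivL := multilinear_cat [:: v] PhiL.
rewrite !ins_ins_cons // [(r * q)%N]mulnC [(r + q)%N]addnC.
have /eqP := IH _ PhivL; rewrite subr_eq => /eqP->.
rewrite /=.
do ![case: ifP => _]; sign_cases; lin_ring K W.
Qed.

End Commutation.

(** * The graded Lie algebra of multilinear maps *)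

Section GradedLie.
Variables (K : fieldType) (V : lmodType K).
Implicit Types (f g h : seq V -> V) (p q r : nat).

Lemma diamondE p q f g vs : size vs = (p + q).+1 ->
  diamond p q f g vs = ins q g f vs.
Proof. by move=> svs; rewrite insE svs subSn ?leq_addl // addnK. Qed.

Lemma Homn_ins p r f g : Homn p f -> Homn r g -> Homn (p + r) (ins r g f).
Proof.
move=> [fL f0] [gL _]; split=> [|vs svs]; first exact: ins_multilinear.
rewrite insE big1 // => i _; rewrite f0 ?scaler0 //.
have lti := ltn_ord i; rewrite size_cat /= size_takel ?size_drop; lia.
Qed.

Lemma ins_wrong_degree p q f g vs r : Homn p f -> Homn q g -> r != q ->
  ins r g f vs = 0.
Proof.
move=> [fL f0] [_ g0] rq; rewrite insE big1 // => i _.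
rewrite g0 ?multilinear0 ?scaler0 //.
by have lti := ltn_ord i; rewrite size_takel ?size_drop; lia.
Qed.

(** On homogeneous maps the bracket is the graded commutator of insertions. *)
Lemma bracketE p q f g : Homn p f -> Homn q g ->
  bracket f g = ins q g f - (-1) ^+ (p * q) *: ins p f g.
Proof.
move=> Hf Hg; apply: funext => vs.
have Hi := Homn_ins Hf Hg; have Hi' := Homn_ins Hg Hf.
rewrite /bracket -[RHS]/(ins q g f vs - (-1) ^+ (p * q) *: ins p f g vs).
have main (k : 'I_(size vs)) : size vs = (p + q).+1 -> k = p :> nat ->
   diamond k (size vs - k.+1) f g vs
   - (-1) ^+ (k * (size vs - k.+1)) *: diamond (size vs - k.+1) k g f vs
   = ins q g f vs - (-1) ^+ (p * q) *: ins p f g vs.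
  move=> svs ->; have -> : (size vs - p.+1 = q)%N by lia.
  by rewrite !diamondE // addnC.
have other (k : 'I_(size vs)) : ~ (size vs = (p + q).+1 /\ k = p :> nat) ->
   diamond k (size vs - k.+1) f g vs
   - (-1) ^+ (k * (size vs - k.+1)) *: diamond (size vs - k.+1) k g f vs = 0.
  move=> nk; have ltk := ltn_ord k.
  rewrite !diamondE; [|lia..].
  have [eq_kp|ne_kp] := eqVneq (k : nat) p; last first.
    rewrite (ins_wrong_degree _ Hg Hf ne_kp) scaler0 subr0.
    have [eq_q|ne_q] := eqVneq (size vs - k.+1)%N q; last first.
      exact: (ins_wrong_degree _ Hf Hg).
    by case: Hi => _ Hi; rewrite eq_q; apply: Hi; lia.
  have nq : (size vs - k.+1)%N != q by lia.
  rewrite (ins_wrong_degree _ Hf Hg nq) eq_kp.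
  by case: Hi' => _ Hi'; rewrite Hi' ?scaler0 ?subr0 //; lia.
have [[svs]|nsvs] := pselect (size vs = (p + q).+1).
  have ltp : (p < size vs)%N by lia.
  rewrite (bigD1 (Ordinal ltp)) // -[RHS](main (Ordinal ltp)) // -[RHS]addr0.
  congr (_ + _); apply: big1 => k /eqP nk; apply: other => -[_ kp].
  by apply: nk; apply: val_inj.
rewrite big1 => [|k _]; last by apply: other => -[].
case: Hi => _ ->; last by apply/eqP.
by case: Hi' => _ ->; rewrite ?scaler0 ?subr0 // addnC; apply/eqP.
Qed.

Lemma Homn_bracket p q f g : Homn p f -> Homn q g ->
  Homn (p + q) (bracket f g).
Proof.
move=> Hf Hg; rewrite (bracketE Hf Hg) addrC -scaleNr.
have [_ HD] := @Homn_submod K V V (p + q).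
by apply: HD; [rewrite addnC|]; apply: Homn_ins.
Qed.

Lemma bracketC p q f g : Homn p f -> Homn q g ->
  bracket f g = - (-1) ^+ (p * q) *: bracket g f.
Proof.
move=> Hf Hg; rewrite (bracketE Hf Hg) (bracketE Hg Hf) mulnC.
by sign_cases; lin_ring K (seq V -> V)%type.
Qed.

Lemma ins_bracket p q r f g h : Homn p f -> Homn q g -> Homn r h ->
  ins (q + r) (bracket g h) f
  = ins r h (ins q g f) - (-1) ^+ (q * r) *: ins q g (ins r h f).
Proof.
move=> [fL _] Hg Hh; apply: funext => vs.
rewrite [RHS]ins_commutator // (bracketE Hg Hh) addrC -scaleNr ins_linearl //.
by rewrite addrC scaleNr.
Qed.

(** The graded Jacobi identity, in derivation form: [-, h] acts on brackets. *)
Lemma bracket_jacobi p q r f g h : Homn p f -> Homn q g -> Homn r h ->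
  bracket (bracket f g) h
  = bracket f (bracket g h) + (-1) ^+ (q * r) *: bracket (bracket f h) g.
Proof.
move=> Hf Hg Hh.
rewrite (bracketE (Homn_bracket Hf Hg) Hh) (bracketE (Homn_bracket Hf Hh) Hg).
rewrite (bracketE Hf (Homn_bracket Hg Hh)).
rewrite (ins_bracket Hf Hg Hh) (ins_bracket Hh Hf Hg) (ins_bracket Hg Hf Hh).
rewrite (bracketE Hf Hg) (bracketE Hf Hh) (bracketE Hg Hh).
rewrite ![_ - _ *: _]addrC -!scaleNr !ins_fctE !scaleNr.
by sign_cases; lin_ring K (seq V -> V)%type.
Qed.

End GradedLie.

(** * Finite sums of homogeneous multilinear maps *)

Section Subspaces.
Variables (K : fieldType) (W : lmodType K) (H : W -> Prop).
Hypothesis sH : is_subspace H.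

Lemma subspace0 : H 0.
Proof. by case: sH. Qed.

Lemma subspaceD x y : H x -> H y -> H (x + y).
Proof. by move=> Hx Hy; rewrite -[x]scale1r; case: sH => _; apply. Qed.

Lemma subspaceZ a x : H x -> H (a *: x).
Proof. by move=> Hx; rewrite -[_ *: _]addr0; case: sH => H0; apply. Qed.

Lemma subspace_sum I (r : seq I) (p : pred I) (F : I -> W) :
  (forall i, p i -> H (F i)) -> H (\sum_(i <- r | p i) F i).
Proof. by move=> HF; apply: big_ind => //; [case: sH|apply: subspaceD]. Qed.

End Subspaces.

Section FiniteSums.
Variables (K : fieldType) (U W : lmodType K).
Implicit Types (f g : seq U -> W).

(** Families of multilinear maps of which finitely many are nonzero, without
    component on the empty list. *)
Definition finite_multilinear f : Prop :=
  [/\ multilinear f, f [::] = 0 & exists N, forall s, (N < size s)%N -> f s = 0].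

(** The component of degree n, that is, with n + 1 inputs. *)
Definition component n f : seq U -> W :=
  fun s => if size s == n.+1 then f s else 0.

Lemma Homn_component n f : multilinear f -> Homn n (component n f).
Proof.
move=> fL; split=> [s t a u v|s /negPf ns]; last by rewrite /component ns.
rewrite /component !size_cat /=; case: ifP => _; first exact: fL.
by rewrite scaler0 addr0.
Qed.

Lemma component_sum f N : f [::] = 0 -> (forall s, (N < size s)%N -> f s = 0) ->
  f = \sum_(n < N) component n f.
Proof.
move=> f0 fN; apply: funext => s; rewrite fct_sumE.
have [ltNs|] := ltnP N (size s).
  by rewrite fN // big1 // => n _; rewrite /component fN ?if_same.
case: s => [|u s] les; first by rewrite f0 big1.
rewrite (bigD1 (Ordinal les)) //= {1}/component eqxx big1 ?addr0 // => n ns.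
by rewrite /component /= eqSS; case: eqP => // es; case/eqP: ns; apply: val_inj.
Qed.

Lemma Homn_finite n f : Homn n f -> finite_multilinear f.
Proof.
move=> [fL f0]; split=> //; first by rewrite f0.
by exists n.+1 => s ns; rewrite f0 // gtn_eqF.
Qed.

Lemma finite_multilinear_sub : is_subspace finite_multilinear.
Proof.
split=> [|a f g [fL f0 [N fN]] [gL g0 [M gM]]].
  by split=> //; [move=> s t a u v; rewrite scaler0 addr0|exists 0%N].
split; first exact: multilinear_comb.
  by rewrite fctcombE f0 g0 scaler0 addr0.
exists (N + M)%N => s sNM; rewrite fctcombE fN ?gM ?scaler0 ?addr0 //; lia.
Qed.

Lemma sum_of_Homn f : sum_of (@Homn K U W) f <-> finite_multilinear f.
Proof.
split=> [[N [y [Hy ->]]]|[fL f0 [N fN]]]; last first.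
  exists N, (component^~ f); split; last exact: component_sum.
  by move=> n; apply: Homn_component.
apply: subspace_sum => [|n _]; first exact: finite_multilinear_sub.
exact: Homn_finite (Hy n).
Qed.

End FiniteSums.

Section BracketClosure.
Variables (K : fieldType) (V : lmodType K).
Implicit Types (f g : seq V -> V).

(** On a list of length p + q + 1 the components of degrees p and q are selected
    by the lengths of the lists to which the maps are applied. *)
Lemma bracket_insE f g vs : bracket f g vs =
  \sum_(p < size vs) (ins (size vs - p.+1) g f vs
     - (-1) ^+ (p * (size vs - p.+1)) *: ins p f g vs).
Proof.
apply: eq_bigr => p _; have ltp := ltn_ord p.
by rewrite /= !diamondE; [|lia..].
Qed.

Lemma bracket_multilinear f g :
  multilinear f -> multilinear g -> multilinear (bracket f g).
Proof.
move=> fL gL s t a u v; rewrite !bracket_insE !size_cat /=.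
rewrite scaler_sumr -big_split; apply: eq_bigr => p _.
rewrite !ins_multilinear // /=; lin_ring K V.
Qed.

Lemma bracket_finite f g :
  finite_multilinear f -> finite_multilinear g -> finite_multilinear (bracket f g).
Proof.
move=> [fL f0 [N fN]] [gL g0 [M gM]]; split; first exact: bracket_multilinear.
  by rewrite bracket_insE big_ord0.
have ins0 (h k : seq V -> V) p q vs : multilinear h -> (forall s, (p < size s)%N -> h s = 0) ->
    (forall s, (q < size s)%N -> k s = 0) ->
    forall r, (r < size vs)%N -> (p + q < size vs)%N -> ins r k h vs = 0.
  move=> hL hp kq r ltr ltpq; rewrite insE big1 // => i _; have lti := ltn_ord i.
  case: (ltnP q r.+1) => qr.
    rewrite kq ?multilinear0 ?scaler0 //.
    by rewrite size_takel ?size_drop; lia.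
  rewrite hp ?scaler0 // size_cat /= size_takel ?size_drop; lia.
exists (N + M)%N => vs lt; rewrite bracket_insE big1 // => p _.
have ltp := ltn_ord p.
rewrite (ins0 f g N M) ?(ins0 g f M N) ?scaler0 ?subr0 //; lia.
Qed.

Lemma bracket_linearl (a : K) f1 f2 g : multilinear g ->
  bracket (a *: f1 + f2) g = a *: bracket f1 g + bracket f2 g.
Proof.
move=> gL; apply: funext => vs; rewrite fctcombE !bracket_insE.
rewrite scaler_sumr -big_split; apply: eq_bigr => p _.
rewrite [ins _ g (_ + _) _]ins_linear ins_linearl // /=; lin_ring K V.
Qed.

Lemma bracket_linearr (a : K) f g1 g2 : multilinear f ->
  bracket f (a *: g1 + g2) = a *: bracket f g1 + bracket f g2.
Proof.
move=> fL; apply: funext => vs; rewrite fctcombE !bracket_insE.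
rewrite scaler_sumr -big_split; apply: eq_bigr => p _.
rewrite [ins p f (_ + _) _]ins_linear ins_linearl // /=; lin_ring K V.
Qed.

Lemma bracket0l g : multilinear g -> bracket 0 g = 0.
Proof.
move=> gL; have := bracket_linearl (-1) 0 0 gL.
by rewrite !scaleN1r oppr0 addr0 addNr.
Qed.

Lemma bracket0r f : multilinear f -> bracket f 0 = 0.
Proof.
move=> fL; have := bracket_linearr (-1) 0 0 fL.
by rewrite !scaleN1r oppr0 addr0 addNr.
Qed.

Lemma bracketZl (a : K) f g : multilinear g -> bracket (a *: f) g = a *: bracket f g.
Proof.
by move=> gL; rewrite -[a *: f]addr0 bracket_linearl // bracket0l // addr0.
Qed.

End BracketClosure.

(** * The subalgebra of maps without component from B to A *)

Section Parts.
Variables (K : fieldType) (A B W : lmodType K).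
Implicit Types (Phi : seq (A * B) -> W) (v : A * B) (vs : seq (A * B)).

(** The component of Phi on the tensor products with exactly k factors A. *)
Fixpoint part (Phi : seq (A * B) -> W) (k : nat) (vs : seq (A * B)) : W :=
  if vs is v :: vs' then
    (if k is k'.+1 then part (fun ws => Phi ((v.1, 0) :: ws)) k' vs' else 0)
    + part (fun ws => Phi ((0, v.2) :: ws)) k vs'
  else if k is 0 then Phi [::] else 0.

Lemma pair_split v : v = (v.1, 0) + (0, v.2).
Proof. by case: v => x y; rewrite /= -[RHS]/(x + 0, 0 + y) addr0 add0r. Qed.

Lemma part0fun Phi k vs : Phi =1 (fun=> 0) -> part Phi k vs = 0.
Proof.
elim: vs Phi k => [|v vs IH] Phi k Phi0 /=; first by case: k.
by rewrite [X in _ + X]IH ?addr0 => [|ws]; first case: k => // k; rewrite ?IH // => ws.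
Qed.

Lemma part_short Phi k vs : (forall ws, size ws = size vs -> Phi ws = 0) ->
  part Phi k vs = 0.
Proof.
elim: vs Phi k => [|v vs IH] Phi k Phi0 /=; first by case: k => //; rewrite Phi0.
rewrite [X in _ + X]IH ?addr0 => [|ws sws]; last by rewrite Phi0 //= sws.
by case: k => // k; rewrite IH // => ws sws; rewrite Phi0 //= sws.
Qed.

Lemma part_0 Phi vs : part Phi 0 vs = Phi [seq (0, v.2) | v <- vs].
Proof. by elim: vs Phi => //= v vs IH Phi; rewrite add0r IH. Qed.

Lemma eq_part Phi Psi k vs : Phi =1 Psi -> part Phi k vs = part Psi k vs.
Proof. by move=> /funext->. Qed.

Lemma part_linear a Phi Psi k vs :
  part (fun ws => a *: Phi ws + Psi ws) k vs = a *: part Phi k vs + part Psi k vs.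
Proof.
elim: vs Phi Psi k => [|v vs IH] Phi Psi [|k] //=; rewrite ?IH; lin_ring K W.
Qed.

Lemma part_multilinear Phi k : multilinear Phi -> multilinear (part Phi k).
Proof.
move=> PhiL s; elim: s Phi k PhiL => [|x s IH] Phi k PhiL t a u v /=; last first.
  rewrite IH; last exact: (multilinear_cat [:: (0, x.2)]).
  case: k => [|k]; first by rewrite !add0r.
  rewrite IH; last exact: (multilinear_cat [:: (x.1, 0)]).
  lin_ring_conv K W.
have E1 ws : Phi ((a *: u.1 + v.1, 0) :: ws)
    = a *: Phi ((u.1, 0) :: ws) + Phi ((v.1, 0) :: ws).
  rewrite -(PhiL [::]) /=; congr (Phi (_ :: _)).
  by rewrite -[RHS]/(_ + _, _ + _) /= scaler0 addr0.
have E2 ws : Phi ((0, a *: u.2 + v.2) :: ws)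
    = a *: Phi ((0, u.2) :: ws) + Phi ((0, v.2) :: ws).
  rewrite -(PhiL [::]) /=; congr (Phi (_ :: _)).
  by rewrite -[RHS]/(_ + _, _ + _) /= scaler0 addr0.
rewrite (eq_part _ _ E2) part_linear; case: k => [|k]; first by lin_ring_conv K W.
rewrite (eq_part _ _ E1) part_linear. lin_ring_conv K W.
Qed.

Lemma part_sum Phi vs N : multilinear Phi -> (size vs < N)%N ->
  \sum_(k < N) part Phi k vs = Phi vs.
Proof.
elim: vs Phi N => [|v vs IH] Phi [|N] // PhiL ltN; rewrite big_ord_recl /=.
  by rewrite big1 ?addr0.
rewrite big_split /= IH //; last exact: (multilinear_cat [:: (v.1, 0)]).
rewrite add0r addrCA -(big_ord_recl _ (fun k => part _ k vs)) IH; first last.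
- by rewrite ltnW.
- exact: (multilinear_cat [:: (0, v.2)]).
by rewrite -(multilinearD [::]) //= -pair_split.
Qed.

Lemma part_calA Phi k w vs : multilinear Phi ->
  all2 (fun c (v : A * B) => if c then inA v else inB v) w vs ->
  part Phi k vs = if k == count_mem true w then Phi vs else 0.
Proof.
elim: w vs Phi k => [|c w IH] [|v vs] Phi k PhiL //=; first by case: k.
case/andP=> cv wvs; have LA u := multilinear_cat [:: u] PhiL.
have -> : v = if c then (v.1, 0) else (0, v.2).
  by case: c v cv => -[x y] /= /eqP /= ->.
case: c cv => cv /=.
  rewrite [X in _ + X]part0fun => [|ws]; last exact: (multilinear0 [::]).
  by case: k => [|k]; rewrite addr0 // add1n (IH _ _ _ (LA _)).
rewrite (IH _ _ _ (LA _)) // add0n; case: k => [|k]; rewrite ?add0r //.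
by rewrite part0fun ?add0r // => ws; apply: (multilinear0 [::]).
Qed.

End Parts.

Section KernelOfP.
Variables (K : fieldType) (A B : lmodType K).
Local Notation V := (A * B)%type.
Implicit Types (F G : seq V -> V).

Lemma P_linear (a : K) F G : P (a *: F + G) = a *: P F + P G.
Proof. by []. Qed.

(** A homogeneous map is a sum of maps of bidegrees (n+1,-1), ..., (0,n) if and
    only if it maps tensors of elements of B to B: bidegree (-1,n+1) is the only
    one that is missing. *)
Lemma QnE n F : Qn n F <-> Homn n F /\ P F = 0.
Proof.
split=> [[f [Hf ->]]|[[FL F0] PF]].
  split; first by apply: subspace_sum => [|i _]; [apply: Homn_submod|case: (Hf i) => [[]]].
  have P0 : P (0 : seq V -> V) = 0 by [].
  apply: (big_ind (fun F => P F = 0)) => // [G1 G2 PG1 PG2|i _].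
    by rewrite -[G1]scale1r P_linear PG1 PG2 scaler0 addr0.
  apply: funext => bs; rewrite /P; have [[_ [_ f0]] _ fB fo] := Hf i.
  set vs := map _ bs.
  have vsB : calA 0 (size bs)%:Z vs.
    exists (nseq (size bs) false).
    rewrite !count_nseq mul0n mul1n /vs; split=> //.
    by elim: (bs) => //= y ys ->; rewrite /inB eqxx.
  have [[ek el]|/eqP ne2] := eqVneq (0, (size bs)%:Z)
      (n%:Z + 1 - i%:Z, i%:Z - 1 + 1).
    by have := fB vs; rewrite -ek -el => /(_ vsB)/eqP.
  rewrite (fo _ _ _ _ _ vsB) //; last by apply/eqP.
  by apply/eqP => -[]; have := ltn_ord i; lia.
(* The i-th summand has bidegree (n + 1 - i, i - 1): its values in A come from
   n + 2 - i factors A, its values in B from n + 1 - i of them. *)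
pose f (i : 'I_n.+2) vs : V :=
  ((part F (n.+2 - i) vs).1, (part F (n.+1 - i) vs).2).
have fL k : multilinear (part F k) := part_multilinear k FL.
have fcalA k p q vs : calA p q vs ->
    part F k vs = if (k%:Z == p) then F vs else 0.
  by case=> w [<- _ wvs]; rewrite (part_calA _ FL wvs) eqz_nat.
have size_calA p q vs : calA p q vs -> (size vs)%:Z = p + q.
  case=> w [<- <-]; elim: w vs => [|c w IH] [|v vs] //= /andP[_ /IH].
  by case: c => /=; lia.
exists f; split=> [i|]; last first.
  apply: funext => vs; rewrite fct_sumE.
  have [svs|ns] := eqVneq (size vs) n.+1; last first.
    rewrite F0 // big1 // => i _.
    by rewrite /f !part_short // => ws sws; rewrite F0 // sws.
  have PF0 : (part F 0 vs).1 = 0.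
    rewrite part_0; have -> : [seq (0 : A, v.2) | v <- vs]
      = [seq (0 : A, y) | y <- [seq v.2 | v <- vs]].
      by elim: (vs) => //= v ws ->.
    by rewrite -[LHS]/(P F _) PF.
  have [fst_sum snd_sum] : (forall N (g : 'I_N -> V), (\sum_k g k).1 = \sum_k (g k).1)
      /\ (forall N (g : 'I_N -> V), (\sum_k g k).2 = \sum_k (g k).2).
    split=> N g; first exact: (big_morph (fun v : V => v.1) (fun _ _ => erefl) erefl).
    exact: (big_morph (fun v : V => v.2) (fun _ _ => erefl) erefl).
  rewrite [LHS]surjective_pairing [RHS]surjective_pairing; congr (_, _).
    rewrite -(part_sum FL (_ : size vs < n.+3)%N) ?svs // !fst_sum.
    rewrite big_ord_recl PF0 add0r (reindex_inj rev_ord_inj).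
    apply: eq_bigr => i _; rewrite lift0 /=; congr (part F _ vs).1.
    by have := ltn_ord i; lia.
  rewrite -(part_sum FL (_ : size vs < n.+2)%N) ?svs // !snd_sum.
  by rewrite (reindex_inj rev_ord_inj).
split.
- split; first by lia.
  split=> [s t a u v|s ns]; last first.
    by rewrite /f !part_short // => ws sws; rewrite F0 // sws.
  by rewrite /f !fL.
- move=> vs /[dup] vsA /fcalA fE; rewrite /inA /f /= fE.
  by case: ifP => // /eqP e; have lti := ltn_ord i; exfalso; lia.
- move=> vs /[dup] vsB /fcalA fE; rewrite /inB /f /= fE.
  by case: ifP => // /eqP e; have lti := ltn_ord i; exfalso; lia.
- have F0' (vs : seq (A * B)) : size vs <> n.+1 -> F vs = 0.
    by move=> ?; apply: F0; apply/eqP.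
  suff main (p q : int) vs : (p, q) <> (n%:Z + 1 - i%:Z + 1, i%:Z - 1) ->
      (p, q) <> (n%:Z + 1 - i%:Z, i%:Z - 1 + 1) -> calA p q vs -> f i vs = 0.
    by move=> p q vs /eqP n1 /eqP n2; apply: main.
  move=> n1 n2 /[dup] /size_calA svs /fcalA fE.
  rewrite /f !fE; have lti := ltn_ord i; case: eqP => [e1|_].
    rewrite F0' ?if_same // => svs'.
    by apply: n1; congr (_, _); lia.
  case: eqP => [e1|//].
  by rewrite F0' // => svs'; apply: n2; congr (_, _); lia.
Qed.

End KernelOfP.

Section DerivedBrackets.
Variables (K : fieldType) (A B : lmodType K).
Local Notation V := (A * B)%type.
Implicit Types (F G X Y : seq V -> V) (f g : seq B -> A).

Lemma P_mapE F : P F = 0 <-> forall bs, (F [seq (0, y) | y <- bs]).1 = 0.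
Proof.
by split=> [PF bs|PF]; [rewrite -[LHS]/(P F bs) PF | apply: funext => bs; apply: PF].
Qed.

Lemma P_multilinear F : multilinear F -> multilinear (P F).
Proof.
move=> FL s t a u v; rewrite /P !map_cat /=.
have -> : (0, a *: u + v) = a *: ((0, u) : V) + (0, v).
  by rewrite -[RHS]/(a *: 0 + 0, _) scaler0 addr0.
by rewrite FL.
Qed.

Lemma P_finite F : finite_multilinear F -> finite_multilinear (P F).
Proof.
move=> [FL F0 [N FN]]; split; first exact: P_multilinear.
  by rewrite /P F0.
by exists N => s sN; rewrite /P FN ?size_map.
Qed.

Lemma P_Homn n F : Homn n F -> Homn n (P F).
Proof.
move=> HF; have [PL _ _] := P_finite (Homn_finite HF); split=> // s ns.
by case: HF => _ F0; rewrite /P F0 ?size_map.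
Qed.

(** Among the finite sums of homogeneous maps, Q is the kernel of P. *)
Lemma Q_predP F : reflect (finite_multilinear F /\ P F = 0) (F \in @Q_pred K A B).
Proof.
have -> : (F \in @Q_pred K A B) = `[< sum_of (@Qn K A B) F >] by [].
apply: (iffP (asboolP _)) => [[N [y [Hy ->]]]|[[FL F0 [N FN]] PF]]; last first.
  exists N, (fun n => component n F); split; last exact: component_sum.
  move=> n; apply/QnE; split; first exact: Homn_component.
  apply/P_mapE => bs; rewrite /component; case: ifP => // _.
  by move/P_mapE: PF; apply.
have Hy' n := (QnE n (y n)).1 (Hy n).
split.
  apply: subspace_sum => [|n _]; first exact: finite_multilinear_sub.
  exact: Homn_finite (Hy' n).1.
apply/P_mapE => bs; rewrite fct_sumE.
rewrite (big_morph (fun v : V => v.1) (fun _ _ => erefl) erefl) big1 // => n _.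
by have [_ /P_mapE] := Hy' n.
Qed.

Lemma b_predP f : reflect (finite_multilinear f) (f \in @b_pred K A B).
Proof.
have -> : (f \in @b_pred K A B) = `[< sum_of (@Homn K B A) f >] by [].
by apply: (iffP (asboolP _)) => /sum_of_Homn.
Qed.

(** The kernel of P is closed under insertions: on elements of B both maps take
    values in B. *)
Lemma P_ins r F G : P F = 0 -> P G = 0 -> P (ins r G F) = 0.
Proof.
move=> /P_mapE PF /P_mapE PG; apply/P_mapE => bs; rewrite insE.
rewrite (big_morph (fun v : V => v.1) (fun _ _ => erefl) erefl) big1 // => i _.
rewrite -!map_drop -!map_take -[LHS]/(_ *: (F _).1).
set v := G _; have -> : v = (0, v.2) by rewrite [LHS]surjective_pairing {1}/v PG.
by rewrite -(map_cons (fun y => (0, y))) -map_cat PF scaler0.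
Qed.

Lemma P_bracket F G : P F = 0 -> P G = 0 -> P (bracket F G) = 0.
Proof.
move=> PF PG; apply/P_mapE => bs; rewrite bracket_insE.
rewrite (big_morph (fun v : V => v.1) (fun _ _ => erefl) erefl) big1 // => i _.
have /P_mapE H1 := P_ins (size [seq (0 : A, y) | y <- bs] - i.+1) PF PG.
have /P_mapE H2 := P_ins i PG PF.
by rewrite -[LHS]/(_ - _ *: _) H1 H2 scaler0 subr0.
Qed.

Lemma ext0_comb (a : K) f g : ext0 (a *: f + g) = a *: ext0 f + ext0 g.
Proof.
apply: funext => vs; rewrite fctcombE /ext0.
by rewrite -[RHS]/(_, a *: 0 + 0) scaler0 addr0.
Qed.

Lemma ext0_multilinear f : multilinear f -> multilinear (ext0 f).
Proof.
move=> fL s t a u v; rewrite /ext0 !map_cat /= fL.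
by rewrite -[RHS]/(_, a *: 0 + 0) scaler0 addr0.
Qed.

Lemma ext0_Homn n f : Homn n f -> Homn n (ext0 f).
Proof.
move=> [fL f0]; split=> [|s ns]; first exact: ext0_multilinear.
by rewrite /ext0 f0 ?size_map.
Qed.

Lemma ext0_finite f : finite_multilinear f -> finite_multilinear (ext0 f).
Proof.
move=> [fL f0 [N fN]]; split; first exact: ext0_multilinear.
  by rewrite /ext0 /= f0.
by exists N => s sN; rewrite /ext0 fN ?size_map.
Qed.

Lemma P_ext0 f : P (ext0 f) = f.
Proof.
apply: funext => bs; rewrite /P /ext0 /=; congr f.
by elim: bs => //= y ys ->.
Qed.

(** The subalgebra b is abelian: its elements take values in A and vanish as
    soon as one argument lies in A. *)
Lemma bracket_ext0 f g : multilinear f -> multilinear g ->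
  bracket (ext0 f) (ext0 g) = 0.
Proof.
have ins0 r f1 g1 vs : multilinear f1 -> ins r (ext0 g1) (ext0 f1) vs = 0.
  move=> fL; rewrite insE big1 // => i _.
  by rewrite /ext0 map_cat /= multilinear0 // scaler0.
move=> fL gL; apply: funext => vs; rewrite bracket_insE big1 // => i _.
by rewrite !ins0 // scaler0 subr0.
Qed.

(** P is compatible with brackets because its kernel and its image are
    subalgebras and the latter is abelian. *)
Lemma P_bracket_split X Y : multilinear X -> multilinear Y ->
  P (bracket X Y) = P (bracket (ext0 (P X)) Y) + P (bracket X (ext0 (P Y))).
Proof.
move=> XL YL.
have PL := P_multilinear.
have eL (Z : seq V -> V) : multilinear Z -> multilinear (ext0 (P Z)).
  by move=> ZL; apply/ext0_multilinear/PL.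
have kL (Z : seq V -> V) : multilinear Z -> multilinear ((-1) *: ext0 (P Z) + Z).
  by move=> ZL; apply: multilinear_comb => //; apply: eL.
have Pk (Z : seq V -> V) : P ((-1) *: ext0 (P Z) + Z) = 0.
  by rewrite P_linear P_ext0 scaleN1r addNr.
have := P_bracket (Pk X) (Pk Y).
rewrite bracket_linearl; last exact: kL.
rewrite !bracket_linearr; [|exact: XL|exact/eL/XL].
rewrite bracket_ext0; [|exact: PL..].
rewrite scaler0 add0r !P_linear => H0.
apply/eqP; rewrite -subr_eq0 -H0; apply/eqP.
lin_ring K (seq B -> A)%type.
Qed.

(** [...[[F, f_1], f_2], ..., f_m] for maps that need not belong to Q and b. *)
Definition itb F (fs : seq (seq B -> A)) : seq V -> V :=
  foldl (fun G f => bracket G (ext0 f)) F fs.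

Lemma itb_cat F s t : itb F (s ++ t) = itb (itb F s) t.
Proof. exact: foldl_cat. Qed.

Lemma itb_finite F fs : finite_multilinear F ->
  List.Forall (@finite_multilinear K B A) fs -> finite_multilinear (itb F fs).
Proof.
elim: fs F => [|f fs IH] F FF //= /List.Forall_cons_iff[Ff Ffs].
by apply: IH => //; apply: bracket_finite => //; apply: ext0_finite.
Qed.

Lemma itb_linear (a : K) F G fs : List.Forall (@multilinear K B A) fs ->
  itb (a *: F + G) fs = a *: itb F fs + itb G fs.
Proof.
elim: fs F G => [|f fs IH] F G //= /List.Forall_cons_iff[fL fsL].
by rewrite bracket_linearl ?IH //; apply: ext0_multilinear.
Qed.

Lemma itbZ (a : K) F fs : List.Forall (@multilinear K B A) fs ->
  itb (a *: F) fs = a *: itb F fs.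
Proof.
move=> fsL; have itb0 : itb 0 fs = 0.
  have := itb_linear (-1) 0 0 fsL.
  by rewrite !scaleN1r oppr0 addr0 addNr.
by rewrite -[a *: F]addr0 itb_linear // itb0 addr0.
Qed.

Lemma itb_linearr (a : K) F s f g t : multilinear (itb F s) ->
  List.Forall (@multilinear K B A) t ->
  itb F (s ++ (a *: f + g) :: t)
    = a *: itb F (s ++ f :: t) + itb F (s ++ g :: t).
Proof.
by move=> HL tL; rewrite !itb_cat /= ext0_comb bracket_linearr // itb_linear.
Qed.

(** Lists of elements of b, each with its degree. *)
Definition homogeneous_list (fs : seq (nat * (seq B -> A))) : Prop :=
  List.Forall (fun e => Homn e.1 e.2) fs.

Definition total_degree (fs : seq (nat * (seq B -> A))) : nat :=
  sumn [seq e.1 | e <- fs].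

Lemma homogeneous_multilinear fs : homogeneous_list fs ->
  List.Forall (@multilinear K B A) [seq e.2 | e <- fs].
Proof.
elim: fs => [|e fs IH] /= H; first by constructor.
by case/List.Forall_cons_iff: H => -[eL _] /IH; constructor.
Qed.

Lemma Homn_itb n F fs : Homn n F -> homogeneous_list fs ->
  Homn (n + total_degree fs) (itb F [seq e.2 | e <- fs]).
Proof.
elim: fs n F => [|e fs IH] n F HF /=; first by rewrite addn0.
case/List.Forall_cons_iff=> He Hfs; rewrite addnA; apply: IH => //.
exact/Homn_bracket/ext0_Homn.
Qed.

(** Since b is abelian, the Jacobi identity makes iterated brackets graded
    symmetric in the elements of b. *)
Lemma itb_swap n F s e e' t : Homn n F ->
  homogeneous_list s -> Homn e.1 e.2 -> Homn e'.1 e'.2 -> homogeneous_list t ->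
  itb F ([seq e.2 | e <- s] ++ e.2 :: e'.2 :: [seq e.2 | e <- t])
  = (-1) ^+ (e.1 * e'.1) *:
    itb F ([seq e.2 | e <- s] ++ e'.2 :: e.2 :: [seq e.2 | e <- t]).
Proof.
move=> HF Hs He He' /homogeneous_multilinear tL; rewrite !itb_cat /= -itbZ //.
congr (itb _ _); have HI := Homn_itb HF Hs.
rewrite (bracket_jacobi HI (ext0_Homn He) (ext0_Homn He')).
rewrite bracket_ext0; [|by case: He|by case: He'].
by rewrite (bracket0r (proj1 HI)) add0r.
Qed.

Lemma itb_move n F s e t : Homn n F ->
  homogeneous_list s -> Homn e.1 e.2 -> homogeneous_list t ->
  itb F ([seq e.2 | e <- s] ++ e.2 :: [seq e.2 | e <- t])
  = (-1) ^+ (e.1 * total_degree s) *: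
    itb F (e.2 :: [seq e.2 | e <- s] ++ [seq e.2 | e <- t]).
Proof.
move=> HF + He; elim/last_ind: s t => [|s e' IH] t Hs Ht.
  by rewrite muln0 expr0 scale1r.
have [Hs' He'] : homogeneous_list s /\ Homn e'.1 e'.2.
  move: Hs; rewrite -cats1 => /List.Forall_app[? /List.Forall_cons_iff[]//].
rewrite -cats1 map_cat -!catA /= (itb_swap HF Hs' He' He Ht).
have Ht' : homogeneous_list (e' :: t) by constructor.
have := IH _ Hs' Ht'; rewrite /= => ->.
rewrite /total_degree map_cat sumn_cat /= addn0 mulnDr scalerA -exprD.
by rewrite addnC [(e'.1 * _)%N]mulnC.
Qed.

End DerivedBrackets.

(** * Signed sums over unshuffles *)

Section Unshuffle.
Variables (K : fieldType) (T : Type) (par : T -> bool).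
Implicit Types (x y : T) (s t xs : seq T).

(** The parity of the total degree of a list. *)
Definition parity s : bool := foldr (fun x b => par x (+) b) false s.

Lemma parity_cat s t : parity (s ++ t) = parity s (+) parity t.
Proof. by elim: s => //= x s ->; rewrite addbA. Qed.

Definition sg (b : bool) : K := (-1) ^+ b.

(** The sum of Phi over all ways of distributing the entries of xs, in order,
    behind those of a1 and a2, with the Koszul sign of moving the entries that
    go to a1 across those that already lie in a2. *)
Fixpoint unshuffle (W : lmodType K) (Phi : seq T -> seq T -> W) (a1 a2 xs : seq T)
    : W :=
  if xs is x :: xs' then
    sg (par x && parity a2) *: unshuffle Phi (rcons a1 x) a2 xs'
    + unshuffle Phi a1 (rcons a2 x) xs'
  else Phi a1 a2.

Section Target.
Variable W : lmodType K.
Implicit Types (Phi Psi : seq T -> seq T -> W).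

Lemma Forall_rcons (p : T -> Prop) s x :
  List.Forall p s -> p x -> List.Forall p (rcons s x).
Proof.
by move=> ps px; rewrite -cats1; apply/List.Forall_app; split=> //; constructor.
Qed.

Lemma unshuffle_in (p : T -> Prop) Phi Psi a1 a2 xs :
  (forall s t, List.Forall p s -> List.Forall p t -> Phi s t = Psi s t) ->
  List.Forall p a1 -> List.Forall p a2 -> List.Forall p xs ->
  unshuffle Phi a1 a2 xs = unshuffle Psi a1 a2 xs.
Proof.
move=> eqP; elim: xs a1 a2 => [|x xs IH] a1 a2 p1 p2 /=; first by rewrite eqP.
by case/List.Forall_cons_iff => px pxs; rewrite !IH //; apply: Forall_rcons.
Qed.

Lemma unshuffle_eq Phi Psi a1 a2 xs : (forall s t, Phi s t = Psi s t) ->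
  unshuffle Phi a1 a2 xs = unshuffle Psi a1 a2 xs.
Proof.
by move=> E; elim: xs a1 a2 => [|x xs IH] a1 a2 //=; rewrite !IH.
Qed.

Lemma unshuffle0 a1 a2 xs : unshuffle (fun _ _ => 0 : W) a1 a2 xs = 0.
Proof. by elim: xs a1 a2 => //= x xs IH a1 a2; rewrite !IH scaler0 addr0. Qed.

Lemma unshuffle_linear (c : K) Phi Psi a1 a2 xs :
  unshuffle (fun s t => c *: Phi s t + Psi s t) a1 a2 xs
  = c *: unshuffle Phi a1 a2 xs + unshuffle Psi a1 a2 xs.
Proof.
by elim: xs a1 a2 => //= x xs IH a1 a2; rewrite !IH; lin_ring K W.
Qed.

Lemma unshuffle_map (W' : lmodType K) (L : W -> W') Phi a1 a2 xs :
  (forall c u v, L (c *: u + v) = c *: L u + L v) ->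
  L (unshuffle Phi a1 a2 xs) = unshuffle (fun s t => L (Phi s t)) a1 a2 xs.
Proof.
by move=> LL; elim: xs a1 a2 => //= x xs IH a1 a2; rewrite LL !IH.
Qed.

(** Entries p1 and p2 placed in front of the two sublists: the entries that go to
    the first one cross p2. *)
Lemma unshuffle_prefix p1 p2 Phi a1 a2 xs :
  unshuffle (fun s t => sg (parity p2 && parity s) *: Phi (p1 ++ s) (p2 ++ t)) a1 a2 xs
  = sg (parity p2 && parity a1) *: unshuffle Phi (p1 ++ a1) (p2 ++ a2) xs.
Proof.
elim: xs a1 a2 => //= x xs IH a1 a2; rewrite !IH !rcons_cat -cats1 !parity_cat /=.
rewrite addbF; case: (par x) (parity p2) (parity a1) (parity a2) => [] [] [] [];
by rewrite /sg /= ?expr0 ?expr1; lin_ring K W.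
Qed.

(** The two sublists can be exchanged, up to the sign of moving one across the
    other. *)
Lemma unshuffle_exchange Phi a1 a2 xs :
  unshuffle (fun s t => sg (parity s && parity t) *: Phi t s) a2 a1 xs
  = sg (parity a1 && parity a2) *: unshuffle Phi a1 a2 xs.
Proof.
elim: xs a1 a2 => [|x xs IH] a1 a2 /=; first by rewrite andbC.
rewrite !IH -!cats1 !parity_cat /= !addbF.
case: (par x) (parity a1) (parity a2) => [] [] [];
by rewrite /sg /= ?expr0 ?expr1; lin_ring K W.
Qed.

Section Additive.
Variables (Phi : seq T -> seq T -> W) (x y z : T).
Hypothesis addl : forall u v w,
  Phi (u ++ z :: v) w = Phi (u ++ x :: v) w + Phi (u ++ y :: v) w.
Hypothesis addr : forall u v w,
  Phi w (u ++ z :: v) = Phi w (u ++ x :: v) + Phi w (u ++ y :: v).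
Hypotheses (parx : par x = par z) (pary : par y = par z).

Lemma unshuffle_addl u v w t : unshuffle Phi (u ++ z :: v) w t
  = unshuffle Phi (u ++ x :: v) w t + unshuffle Phi (u ++ y :: v) w t.
Proof.
elim: t v w => [|c t IH] v w /=; first exact: addl.
rewrite !rcons_cat /= !IH; lin_ring K W.
Qed.

Lemma unshuffle_addr u v w t : unshuffle Phi w (u ++ z :: v) t
  = unshuffle Phi w (u ++ x :: v) t + unshuffle Phi w (u ++ y :: v) t.
Proof.
elim: t v w => [|c t IH] v w /=; first exact: addr.
rewrite !rcons_cat /= !IH !parity_cat /= parx pary; lin_ring K W.
Qed.

Lemma unshuffle_add a1 a2 s t : unshuffle Phi a1 a2 (s ++ z :: t)
  = unshuffle Phi a1 a2 (s ++ x :: t) + unshuffle Phi a1 a2 (s ++ y :: t).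
Proof.
elim: s a1 a2 => [|c s IH] a1 a2 /=; last by rewrite !IH; lin_ring K W.
rewrite -!cats1 unshuffle_addl unshuffle_addr parx pary; lin_ring K W.
Qed.

End Additive.

Section Swap.
Variables (p : T -> Prop) (Phi : seq T -> seq T -> W).
Hypothesis swapl : forall u x y v w,
  List.Forall p (u ++ x :: y :: v) -> List.Forall p w ->
  Phi (u ++ x :: y :: v) w = sg (par x && par y) *: Phi (u ++ y :: x :: v) w.
Hypothesis swapr : forall u x y v w,
  List.Forall p (u ++ x :: y :: v) -> List.Forall p w ->
  Phi w (u ++ x :: y :: v) = sg (par x && par y) *: Phi w (u ++ y :: x :: v).

Lemma unshuffle_swapl u x y v w t : List.Forall p (u ++ x :: y :: v) ->
  List.Forall p w -> List.Forall p t ->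
  unshuffle Phi (u ++ x :: y :: v) w t
    = sg (par x && par y) *: unshuffle Phi (u ++ y :: x :: v) w t.
Proof.
elim: t v w => [|z t IH] v w pu pw /=; first by move=> _; apply: swapl.
case/List.Forall_cons_iff => pz pt; rewrite !rcons_cat /= !IH //.
- lin_ring K W.
- exact: Forall_rcons.
- by rewrite -2!rcons_cons -rcons_cat; apply: Forall_rcons.
Qed.

Lemma unshuffle_swapr u x y v w t : List.Forall p (u ++ x :: y :: v) ->
  List.Forall p w -> List.Forall p t ->
  unshuffle Phi w (u ++ x :: y :: v) t
    = sg (par x && par y) *: unshuffle Phi w (u ++ y :: x :: v) t.
Proof.
elim: t v w => [|z t IH] v w pu pw /=; first by move=> _; apply: swapr.
case/List.Forall_cons_iff => pz pt; rewrite !rcons_cat /= !IH //.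
- rewrite !parity_cat /= (addbCA (par x)); lin_ring K W.
- by rewrite -2!rcons_cons -rcons_cat; apply: Forall_rcons.
- exact: Forall_rcons.
Qed.

(** The sum is graded symmetric when Phi is in both arguments. *)
Lemma unshuffle_swap a1 a2 s x y t :
  List.Forall p a1 -> List.Forall p a2 -> List.Forall p (s ++ x :: y :: t) ->
  unshuffle Phi a1 a2 (s ++ x :: y :: t)
    = sg (par x && par y) *: unshuffle Phi a1 a2 (s ++ y :: x :: t).
Proof.
elim: s a1 a2 => [|z s IH] a1 a2 p1 p2 /=; last first.
  case/List.Forall_cons_iff => pz ps.
  rewrite !IH //; [|exact: Forall_rcons..]; lin_ring K W.
case/List.Forall_cons_iff => px /List.Forall_cons_iff[py pt].
have pxy u : List.Forall p u -> List.Forall p (u ++ [:: x; y]).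
  by move=> pu; apply/List.Forall_app; split=> //; do ![constructor].
rewrite -!cats1 -!catA /= (unshuffle_swapl (pxy _ p1)) //.
rewrite (unshuffle_swapr (pxy _ p2)) // !parity_cat /= !addbF.
case: (par x) (par y) (parity a2) => [] [] [];
by rewrite /sg /= ?expr0 ?expr1; lin_ring K W.
Qed.

End Swap.

End Target.
End Unshuffle.

Lemma unshuffle_comap (K : fieldType) (T T' : Type) (W : lmodType K)
    (par : T -> bool) (h : T' -> T) (Phi : seq T -> seq T -> W) a1 a2 xs :
  unshuffle par Phi (map h a1) (map h a2) (map h xs)
  = unshuffle (fun x => par (h x)) (fun s t => Phi (map h s) (map h t)) a1 a2 xs.
Proof.
elim: xs a1 a2 => //= x xs IH a1 a2; rewrite -!map_rcons !IH; congr (sg _ _ *: _ + _).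
by congr (_ && _); elim: a2 {IH} => //= y s ->.
Qed.

(** * Koszul signs and shuffles *)

Section KoszulSign.
Variables (K : fieldType) (N : nat).
Implicit Types (par : 'I_N -> bool) (w : seq 'I_N).

(** The Koszul sign of a list of indices: one factor for each inversion. *)
Fixpoint inversion_sign par w : K :=
  if w is a :: w' then
    (\prod_(c <- w' | (c < a)%N) sg K (par a && par c)) * inversion_sign par w'
  else 1.

Lemma signz_odd (z : int) : (-1) ^ z = sg K (odd `|z|%N) :> K.
Proof.
rewrite /sg signr_odd; case: z => n //.
by rewrite -[LHS]/((-1) ^- n.+1) invr_sign.
Qed.

Lemma inversion_signE par w (x0 : 'I_N) :
  inversion_sign par w = \prod_(i < size w)
    \prod_(j < size w | (i < j)%N && (nth x0 w j < nth x0 w i)%N)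
      sg K (par (nth x0 w i) && par (nth x0 w j)).
Proof.
elim: w => [|a w IH]; first by rewrite big_ord0.
rewrite big_ord_recl /= IH; congr (_ * _).
  rewrite [RHS]big_mkcond [RHS]big_ord_recl /= mul1r (big_nth x0) big_mkord big_mkcond.
  by apply: eq_bigr => i _.
apply: eq_bigr => i _; rewrite [RHS]big_mkcond [RHS]big_ord_recl /= mul1r [LHS]big_mkcond.
by apply: eq_bigr => j _.
Qed.

Lemma koszulE (d : 'I_N -> int) (sigma : 'S_N) :
  koszul K d sigma
  = inversion_sign (fun i => odd `|d i|%N) [seq sigma i | i <- enum 'I_N].
Proof.
have [N0|/card_gt0P[x0 _]] := posnP #|'I_N|.
  rewrite card_ord in N0; rewrite /koszul big1; last first.
    by move=> i; have := ltn_ord i; rewrite {2}N0.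
  by rewrite (size0nil (_ : size (enum 'I_N) = 0%N)) // size_enum_ord N0.
rewrite (inversion_signE _ _ x0) size_map size_enum_ord; apply: eq_bigr => i _.
have E (k : 'I_N) : nth x0 [seq sigma i | i <- enum 'I_N] k = sigma k.
  by rewrite (nth_map x0) ?size_enum_ord // nth_ord_enum.
rewrite E; apply: eq_big => [j|j _]; rewrite E //.
by rewrite signz_odd abszM oddM.
Qed.

Lemma inversion_sign_sorted par w : sorted ltn [seq val i | i <- w] ->
  inversion_sign par w = 1.
Proof.
elim: w => //= a w IH pw; rewrite IH ?(path_sorted pw) // mulr1.
rewrite big_seq_cond big1 // => c /andP[cw ca].
have /allP/(_ (val c)) := order_path_min ltn_trans pw.
by rewrite map_f // => /(_ isT) /ltnW; rewrite leqNgt ca.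
Qed.

End KoszulSign.

Section Shuffles.
Variables (K : fieldType) (N : nat) (par : 'I_N -> bool) (W : lmodType K).
Implicit Types (w a : seq 'I_N) (S : {set 'I_N}).
Variable Phi : seq 'I_N -> seq 'I_N -> W.

(** A distribution of the entries of w is a subset S, and its sign is the Koszul
    sign of the list in which the chosen entries precede those of a2, which lie
    before w, and the other entries of w. *)
Lemma unshuffle_subsets a1 a2 w : sorted ltn [seq val i | i <- a2 ++ w] ->
  unshuffle par Phi a1 a2 w = \sum_(S : {set 'I_N} | S \subset [set x in w])
    inversion_sign K par ([seq x <- w | x \in S] ++ a2 ++ [seq x <- w | x \notin S])
    *: Phi (a1 ++ [seq x <- w | x \in S]) (a2 ++ [seq x <- w | x \notin S]).
Proof.
elim: w a1 a2 => [|x w IH] a1 a2 sw /=.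
  have -> : [set x in [::]] = set0 :> {set 'I_N} by apply/setP => x; rewrite !inE.
  rewrite (eq_bigl (pred1 set0)) => [|S]; last by rewrite subset0.
  by rewrite big_pred1_eq /= !cats0 inversion_sign_sorted ?scale1r // -[a2]cats0.
have sx : sorted ltn [seq val i | i <- x :: w].
  by move: sw; rewrite map_cat => /cat_sorted2[].
have xw : x \notin w.
  apply/negP => xw; have /allP/(_ (val x)) := order_path_min ltn_trans sx.
  by rewrite map_f // => /(_ isT); rewrite /= ltnn.
have notS S : S \subset [set z in w] -> x \notin S.
  by move=> /subsetP Sw; apply: contra xw => /Sw; rewrite inE.
have sw' : sorted ltn [seq val i | i <- a2 ++ w].
  apply: (subseq_sorted ltn_trans) sw.
  by rewrite map_subseq // cat_subseq // subseq_cons.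
have a2x c : c \in a2 -> (c < x)%N.
  move=> ca; move: sw; rewrite map_cat; case/splitPr: ca => b1 b2.
  rewrite map_cat -catA /= => /cat_sorted2[_].
  move=> /(order_path_min ltn_trans)/allP/(_ (val x)); apply.
  by rewrite mem_cat (map_f val (mem_head x w)) orbT.
have ltx c : c \in w -> (c < x)%N = false.
  move=> cw; have /allP/(_ (val c)) := order_path_min ltn_trans sx.
  by rewrite map_f // => /(_ isT) /ltnW; rewrite leqNgt => /negbTE.
rewrite [RHS](bigID (fun S : {set 'I_N} => x \in S)) /=; congr (_ + _).
  rewrite (reindex_onto (fun S => x |: S) (fun S => S :\ x)) /=; last first.
    by move=> S /andP[_ xS]; rewrite setD1K.
  rewrite IH // scaler_sumr; apply: eq_big => [S|S Sw].
    rewrite setU11 andbT; apply/idP/andP => [Sw|[Sxw /eqP Sx]].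
      split; last by rewrite setU1K ?notS.
      rewrite subUset sub1set !inE eqxx (subset_trans Sw) //.
      by apply/subsetP => z; rewrite !inE => ->; rewrite orbT.
    apply/subsetP => z zS; have zx : z != x by move: zS; rewrite -Sx !inE => /andP[].
    have /(subsetP Sxw) : z \in x |: S by rewrite !inE zS orbT.
    by rewrite !inE (negPf zx).
  have xS := notS _ Sw; rewrite setU11 /=.
  have inS z : z \in w -> (z \in x |: S) = (z \in S).
    by move=> zw; rewrite !inE; case: eqP zw xw => // -> ->.
  have -> : [seq z <- w | z \in x |: S] = [seq z <- w | z \in S].
    exact/eq_in_filter.
  have -> : [seq z <- w | z \notin x |: S] = [seq z <- w | z \notin S].
    by apply/eq_in_filter => z zw; rewrite inS.
  rewrite cat_rcons scalerA; congr (_ *: _).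
  apply: esym; rewrite /= big_cat /=.
  rewrite [X in X * _ * _]big1_seq ?mul1r => [|c /andP[cx]]; last first.
    by rewrite mem_filter => /andP[_ /ltx]; rewrite cx.
  rewrite big_cat /= [X in _ * X * _]big1_seq ?mulr1 => [|c /andP[cx]]; last first.
    by rewrite mem_filter => /andP[_ /ltx]; rewrite cx.
  congr (_ * _); rewrite -big_filter (all_filterP _); last by apply/allP.
  elim: (a2) => [|c b IHb] /=.
    by rewrite big_nil andbF.
  by rewrite big_cons IHb andb_addr /sg signr_addb.
rewrite IH; last by rewrite cat_rcons.
apply: eq_big => [S|S Sw].
  apply/idP/andP => [Sw|[Sw xS]].
    split; last exact: notS.
    by apply: (subset_trans Sw); apply/subsetP => z; rewrite !inE => ->; rewrite orbT.
  apply/subsetP => z zS; have /(subsetP Sw) := zS; rewrite !inE.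
  by case: eqP zS xS => // -> ->.
by rewrite (negPf (notS _ Sw)) /= -!cats1 -!catA.
Qed.

End Shuffles.

Lemma size_map_enum (N : nat) (T : Type) (f : 'I_N -> T) :
  size [seq f l | l <- enum 'I_N] = N.
Proof. by rewrite size_map size_enum_ord. Qed.

Lemma nth_map_enum (N : nat) (T : Type) (f : 'I_N -> T) x0 k (ltk : (k < N)%N) :
  nth x0 [seq f l | l <- enum 'I_N] k = f (Ordinal ltk).
Proof.
have := @nth_map 'I_N (Ordinal ltk) T x0 f k (enum 'I_N).
rewrite size_enum_ord => /(_ ltk) ->.
by congr (f _); apply: val_inj; rewrite /= nth_enum_ord.
Qed.

Section ShuffleSum.
Variables (K : fieldType) (N : nat).
Implicit Types (S : {set 'I_N}) (sigma : 'S_N) (i : nat).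

Lemma sorted_enum_ord : sorted ltn [seq val k | k <- enum 'I_N].
Proof. by rewrite val_enum_ord iota_ltn_sorted. Qed.

(** The elements of S in increasing order. *)
Definition selected S : seq 'I_N := [seq k <- enum 'I_N | k \in S].

Lemma mem_selected S k : (k \in selected S) = (k \in S).
Proof. by rewrite mem_filter mem_enum andbT. Qed.

Lemma sorted_selected S : sorted ltn [seq val k | k <- selected S].
Proof.
apply: (subseq_sorted ltn_trans) sorted_enum_ord.
by rewrite map_subseq // filter_subseq.
Qed.

Lemma size_selected S : size (selected S) = #|S|.
Proof. by rewrite cardE /enum_mem /selected enumT. Qed.

Lemma selected_unique S w : sorted ltn [seq val k | k <- w] -> w =i S ->
  w = selected S.
Proof.
move=> sw wS; apply: (inj_map val_inj); apply: (irr_sorted_eq ltn_trans ltnn) => //.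
  exact: sorted_selected.
by apply: eq_mem_map => k; rewrite wS mem_selected.
Qed.

Lemma unshuffled_inj S : injective (fun k => nth k (selected S ++ selected (~: S)) k).
Proof.
have sz : size (selected S ++ selected (~: S)) = N.
  by rewrite size_cat !size_selected cardsC card_ord.
have un : uniq (selected S ++ selected (~: S)).
  have unS S' : uniq (selected S') := filter_uniq _ (enum_uniq 'I_N).
  rewrite cat_uniq !unS andbT; apply/hasPn => k.
  by rewrite !mem_selected inE.
move=> k l; rewrite (set_nth_default l) ?sz // => /eqP.
by rewrite nth_uniq ?sz // => /eqP/val_inj.
Qed.

(** The permutation that lists the elements of S before the others. *)
Definition unshuffling S : 'S_N := perm (@unshuffled_inj S).

Lemma unshufflingE S :
  [seq unshuffling S k | k <- enum 'I_N] = selected S ++ selected (~: S).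
Proof.
have sz : size (selected S ++ selected (~: S)) = N.
  by rewrite size_cat !size_selected cardsC card_ord.
have [N0|/card_gt0P[x0 _]] := posnP #|'I_N|.
  rewrite card_ord in N0; rewrite (size0nil (_ : size (enum 'I_N) = 0%N)).
    by rewrite (size0nil (_ : size (_ ++ _) = 0%N)) // sz N0.
  by rewrite size_enum_ord N0.
apply: (@eq_from_nth _ x0) => [|k]; rewrite size_map size_enum_ord ?sz // => ltk.
rewrite (nth_map_enum _ _ ltk) permE.
by apply: set_nth_default; rewrite sz.
Qed.

Lemma koszul_unshuffling (d : 'I_N -> int) S : koszul K d (unshuffling S)
  = inversion_sign K (fun k => odd `|d k|%N) (selected S ++ selected (~: S)).
Proof. by rewrite koszulE unshufflingE. Qed.

Lemma shuffle_sorted i sigma : is_shuffle i sigma ->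
  sorted ltn [seq val k | k <- take i [seq sigma k | k <- enum 'I_N]] /\
  sorted ltn [seq val k | k <- drop i [seq sigma k | k <- enum 'I_N]].
Proof.
move=> /forallP sh; have sz : size [seq sigma k | k <- enum 'I_N] = N.
  by rewrite size_map size_enum_ord.
have [N0|/card_gt0P[x0 _]] := posnP #|'I_N|.
  by rewrite card_ord in N0; rewrite (size0nil (etrans sz N0)).
have step k : (k.+1 < N)%N -> (k.+1 < i)%N || (i <= k)%N ->
   (nth x0 [seq sigma k | k <- enum 'I_N] k
     < nth x0 [seq sigma k | k <- enum 'I_N] k.+1)%N.
  move=> ltk ki; rewrite (nth_map_enum _ _ ltk) (nth_map_enum _ _ (ltnW ltk)).
  have /forallP/(_ (Ordinal ltk))/implyP := sh (Ordinal (ltnW ltk)).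
  by rewrite /= ltnSn ki => /(_ isT).
split; apply/(sortedP 0%N) => k; rewrite size_map => ltk.
  rewrite (nth_map x0 _ _ ltk) (nth_map x0 _ _ (ltnW ltk)); move: ltk.
  rewrite size_take_min sz ltn_min.
  case/andP=> ki kN; rewrite /ltn /= (nth_take _ ki) (nth_take _ (ltnW ki)).
  by apply: step; rewrite ?ki.
rewrite (nth_map x0 _ _ ltk) (nth_map x0 _ _ (ltnW ltk)); move: ltk; rewrite size_drop sz => ltk.
by rewrite /ltn /= !nth_drop addnS; apply: step; lia.
Qed.

Lemma is_shuffle_unshuffling S : is_shuffle #|S| (unshuffling S).
Proof.
apply/forallP => a; apply/forallP => c; apply/implyP => /andP[ac].
have E k : unshuffling S k = nth a (selected S ++ selected (~: S)) k.
  rewrite permE; apply: set_nth_default.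
  by rewrite size_cat !size_selected cardsC card_ord.
have lt_nth S' k l : (k < l < #|S'|)%N ->
    (nth a (selected S') k < nth a (selected S') l)%N.
  move=> /andP[kl lS]; have lS' : (l < size (selected S'))%N by rewrite size_selected.
  have := sorted_ltn_nth ltn_trans 0%N (sorted_selected S').
  move=> /(_ k l); rewrite !inE !size_map => /(_ (ltn_trans kl lS') lS' kl).
  by rewrite !(nth_map a) // (ltn_trans kl).
rewrite !E !nth_cat !size_selected.
have cN : #|~: S| = (N - #|S|)%N by rewrite cardsCs setCK card_ord.
case/orP => [cS|aS].
  by rewrite cS (ltn_trans ac cS); apply: lt_nth; rewrite ac.
have cS : (#|S| <= c)%N by apply: leq_trans (ltnW ac).
rewrite [(a < _)%N]ltnNge aS [(c < _)%N]ltnNge cS /=.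
apply: lt_nth; rewrite cN; have ltc := ltn_ord c.
move: #|S| aS cS => m aS cS; lia.
Qed.

Lemma take_unshuffling S :
  take #|S| [seq unshuffling S k | k <- enum 'I_N] = selected S.
Proof. by rewrite unshufflingE -size_selected take_size_cat. Qed.

Lemma drop_unshuffling S :
  drop #|S| [seq unshuffling S k | k <- enum 'I_N] = selected (~: S).
Proof. by rewrite unshufflingE -size_selected drop_size_cat. Qed.

(** An (i, N - i)-shuffle is determined by the set of its first i values. *)
Lemma reindex_shuffles (W : lmodType K) i (F : 'S_N -> W) : (i <= N)%N ->
  \sum_(sigma : 'S_N | is_shuffle i sigma) F sigma
  = \sum_(S : {set 'I_N} | #|S| == i) F (unshuffling S).
Proof.
move=> iN; pose head_set sigma : {set 'I_N} :=
  [set k in take i [seq sigma l | l <- enum 'I_N]].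
have card_head sigma : #|head_set sigma| = i.
  have un : uniq (take i [seq sigma l | l <- enum 'I_N]).
    by rewrite take_uniq // map_inj_uniq ?enum_uniq //; apply: perm_inj.
  by rewrite cardsE (card_uniqP un) size_takel // size_map size_enum_ord.
rewrite (reindex_onto unshuffling head_set) => [|sigma sh].
  apply: eq_bigl => S; apply/andP/eqP => [[_ /eqP <-]//|Si].
  split; first by rewrite -Si is_shuffle_unshuffling.
  by apply/eqP/setP => k; rewrite inE -Si take_unshuffling mem_selected.
have [s1 s2] := shuffle_sorted sh.
apply/permP => k.
have un : uniq [seq sigma l | l <- enum 'I_N].
  by rewrite map_inj_uniq ?enum_uniq //; apply: perm_inj.
have E : [seq unshuffling (head_set sigma) l | l <- enum 'I_N]
    = [seq sigma l | l <- enum 'I_N].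
  rewrite unshufflingE -[RHS](cat_take_drop i); congr (_ ++ _); apply: esym.
    by apply: selected_unique => // l; rewrite inE.
  apply: selected_unique => // l; rewrite !inE.
  move: un; rewrite -{1}(cat_take_drop i [seq _ | _ <- _]) cat_uniq.
  case/and3P=> _ /hasPn dj _; apply/idP/idP => [/dj//|].
  have : l \in [seq sigma l | l <- enum 'I_N].
    by rewrite -[l](permKV sigma) map_f ?mem_enum.
  by rewrite -{1}(cat_take_drop i [seq _ | _ <- _]) mem_cat => /orP[->|].
by have /eq_in_map/(_ k) := E; apply; rewrite mem_enum.
Qed.

(** The sum over shuffles in the generalized Jacobi identity is a sum over
    unshuffles. *)
Lemma shuffle_sumE (W : lmodType K) (d : 'I_N -> int)
    (Psi : seq 'I_N -> seq 'I_N -> W) :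
  \sum_(1 <= i < N.+1) \sum_(sigma : 'S_N | is_shuffle i sigma)
    koszul K d sigma *: Psi (take i [seq sigma k | k <- enum 'I_N])
                            (drop i [seq sigma k | k <- enum 'I_N])
  = unshuffle (fun k => odd `|d k|%N)
      (fun s t => if s is [::] then 0 else Psi s t) [::] [::] (enum 'I_N).
Proof.
rewrite unshuffle_subsets ?cat0s ?sorted_enum_ord //=.
rewrite [RHS](eq_bigl predT) => [|S] /=; last first.
  by apply/subsetP => k _; rewrite inE mem_enum.
rewrite [RHS](partition_big (fun S : {set 'I_N} => inord #|S| : 'I_N.+1) predT) //=.
rewrite [RHS]big_ord_recl /= big_add1 /= big_mkord [X in _ = X + _]big1 => [|S]; last first.
  move=> /eqP/(congr1 val); rewrite /= inordK => [/eqP|]; last first.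
    by rewrite ltnS -[X in (_ <= X)%N]card_ord max_card.
  rewrite cards_eq0 => /eqP->.
  by rewrite (_ : [seq x <- enum 'I_N | x \in finset.set0] = [::]) ?scaler0 //;
     apply/eqP; rewrite -size_eq0 -/(selected _) size_selected cards0.
rewrite add0r; apply: eq_bigr => i _; rewrite reindex_shuffles //; last first.
apply: eq_big => [S|S /eqP Si].
  rewrite -val_eqE /= inordK // ltnS -[X in (_ <= X)%N]card_ord; exact: max_card.
rewrite -Si koszul_unshuffling take_unshuffling drop_unshuffling.
rewrite -/(selected S); have -> : [seq x <- enum 'I_N | x \notin S] = selected (~: S).
  by apply: eq_filter => k; rewrite inE.
by case: (selected S) (size_selected S) => //; rewrite Si.
Qed.

End ShuffleSum.

(** * Graded symmetry through adjacent transpositions *)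

Lemma Forall_nth (T : Type) (p : T -> Prop) x0 s i :
  List.Forall p s -> (i < size s)%N -> p (nth x0 s i).
Proof.
elim: s i => [|y s IH] [|i] //= /List.Forall_cons_iff[py ps] //; exact: IH.
Qed.

Lemma sorted_insert N (a : 'I_N) s : sorted ltn [seq val i | i <- s] -> a \notin s ->
  exists u v, [/\ s = u ++ v, sorted ltn [seq val i | i <- u ++ a :: v],
    all (fun c : 'I_N => c < a)%N u & all (fun c : 'I_N => ~~ (c < a)%N) v].
Proof.
elim: s => [|c s IH] /=; first by exists [::], [::].
rewrite (path_sortedE ltn_trans) inE negb_or => /andP[cs ss] /andP[ac as'].
have [lt_ac|le_ca] := ltnP a c.
  exists [::], (c :: s); rewrite /= lt_ac (path_sortedE ltn_trans) cs ss.
  split=> //; rewrite -leqNgt ltnW //=; move: cs; rewrite all_map.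
  by apply: sub_all => k /= ltck; rewrite -leqNgt ltnW // (ltn_trans lt_ac).
have lt_ca : (c < a)%N by rewrite ltn_neqAle le_ca andbT eq_sym.
have [u [v [sE su au av]]] := IH ss as'.
exists (c :: u), v; rewrite /= lt_ca sE (path_sortedE ltn_trans) su andbT.
split=> //; move: cs; rewrite sE !map_cat !all_cat /= => /andP[-> ->].
by rewrite lt_ca.
Qed.

Section GradedSymmetry.
Variables (K : fieldType) (W : lmodType K) (gr : int -> W -> Prop) (l : seq W -> W).

(** Elements are accompanied by their degrees: (d, x) with x of degree d. *)
Definition homogeneous (e : int * W) : Prop := gr e.1 e.2.
Definition item_parity (e : int * W) : bool := odd `|e.1|%N.
Definition values (es : seq (int * W)) : seq W := [seq e.2 | e <- es].

(** Graded symmetry for adjacent transpositions only. *)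
Definition swap_symmetric : Prop := forall s x y t,
  List.Forall homogeneous (s ++ x :: y :: t) ->
  l (values (s ++ x :: y :: t))
  = sg K (item_parity x && item_parity y) *: l (values (s ++ y :: x :: t)).

Lemma move_to_front : swap_symmetric -> forall p u e v,
  List.Forall homogeneous (p ++ u ++ e :: v) ->
  l (values (p ++ u ++ e :: v))
  = sg K (item_parity e && parity item_parity u) *: l (values (p ++ e :: u ++ v)).
Proof.
move=> sw p; elim/last_ind => [|u c IH] e v Hpuev.
  by rewrite /= andbF scale1r.
move: Hpuev; rewrite -cats1 -!catA /= catA => Hpuev.
rewrite (sw _ _ _ _ Hpuev) -catA IH; last first.
  move: Hpuev; rewrite -catA !List.Forall_app !List.Forall_cons_iff.
  by case=> ? [? [? [? ?]]].
rewrite scalerA parity_cat /= addbF andb_addr [item_parity c && _]andbC.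
by rewrite /sg signr_addb mulrC.
Qed.

Lemma graded_symmetric_swap : graded_symmetric gr l -> swap_symmetric.
Proof.
move=> gs s x y t Hs; pose xs := s ++ x :: y :: t.
pose N := size xs; have sN : N = (size s + (size t).+2)%N by rewrite /N size_cat.
have lt1 : (size s < N)%N by rewrite sN; lia.
have lt2 : ((size s).+1 < N)%N by rewrite sN; lia.
pose i1 := Ordinal lt1; pose i2 := Ordinal lt2.
have ne12 : i1 != i2 by rewrite -val_eqE /= neq_ltn ltnSn.
have nth1 : nth x xs i1 = x by rewrite nth_cat ltnn subnn.
have nth2 : nth x xs i2 = y by rewrite nth_cat /= ltnNge leqnSn subSnn.
pose z i := nth x xs i.
pose sigma := tperm i1 i2 : 'S_N.
have := gs N (fun i => (z i).2) (fun i => (z i).1) sigma.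
move=> /(_ (fun i => Forall_nth x Hs (ltn_ord i))).
have -> : permuted (fun i : 'I_N => (z i).2) 1%g = values xs.
  apply: (@eq_from_nth _ 0); rewrite size_map_enum ?size_map // => k ltk.
  by rewrite (nth_map_enum _ _ ltk) perm1 (nth_map x).
have -> : permuted (fun i : 'I_N => (z i).2) sigma = values (s ++ y :: x :: t).
  have sy : size (s ++ y :: x :: t) = N by rewrite sN size_cat.
  apply: (@eq_from_nth _ 0); rewrite size_map_enum ?size_map ?sy // => k ltk.
  rewrite (nth_map_enum _ _ ltk) (nth_map x) ?sy //.
  congr (_.2); rewrite /z /xs /sigma.
  case: tpermP => [/(congr1 val)/= ->|/(congr1 val)/= ->|/eqP ne1 /eqP ne2] /=.
  - by rewrite !nth_cat /= ltnn ltnNge leqnSn subnn subSnn.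
  - by rewrite !nth_cat /= ltnn ltnNge leqnSn subnn subSnn.
  rewrite -!val_eqE /= in ne1 ne2; rewrite !nth_cat; case: ltnP => // le.
  have : (k - size s >= 2)%N by lia.
  by case: (k - size s)%N => [|[|m]].
move=> ->; congr (_ *: _); rewrite /koszul (bigD1 i1) //= (bigD1 i2) /=; last first.
  by rewrite tpermL tpermR /= !ltnSn.
rewrite tpermL tpermR signz_odd abszM oddM /z nth1 nth2 andbC.
rewrite -[RHS]mulr1 -mulrA; congr (_ * _).
have inv (k j : 'I_N) : (k < j)%N -> (sigma j < sigma k)%N -> k = i1 /\ j = i2.
  rewrite /sigma => lt_kj lt_jk.
  have [kE jE] : k = size s :> nat /\ j = (size s).+1 :> nat.
    move: lt_kj lt_jk; rewrite !permE /= -!val_eqE /=.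
    by do 2![case: eqP => ? /=; last case: eqP => ? /=]; lia.
  by split; apply: val_inj.
rewrite [X in X * _]big1 ?mul1r => [|k /andP[/andP[lt1k lts] nek2]]; last first.
  have [|_ E2] := inv i1 k lt1k; first by rewrite {2}/sigma tpermL.
  by rewrite E2 eqxx in nek2.
rewrite big1 // => k nek1.
rewrite big1 // => j /andP[lt1' lt2'].
by have [E1 _] := inv _ _ lt1' lt2'; rewrite E1 eqxx in nek1.
Qed.

(** Adjacent transpositions generate all permutations, and the sign of an
    insertion sort is the Koszul sign. *)
Lemma swap_graded_symmetric : swap_symmetric -> graded_symmetric gr l.
Proof.
move=> sw N x d sigma Hx; pose par i := odd `|d i|%N.
pose it (w : seq 'I_N) := [seq (d i, x i) | i <- w].
have Hit w : List.Forall homogeneous (it w).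
  by elim: w => [|a w IH]; constructor => //; apply: Hx.
have parE w : parity item_parity (it w) = parity par w by elim: w => //= a w ->.
have it_cat u v : it (u ++ v) = it u ++ it v by apply: map_cat.
have sortw (w : seq 'I_N) : uniq w -> exists w', [/\ perm_eq w' w,
   sorted ltn [seq val i | i <- w'] & forall p,
   l (values (it (p ++ w'))) = inversion_sign K par w *: l (values (it (p ++ w)))].
  elim: w => [|a w IH] /=; first by exists [::]; split=> // p; rewrite scale1r.
  case/andP=> aw /IH[w' [pw sw' lw']].
  have aw' : a \notin w' by rewrite (perm_mem pw).
  have [u [v [w'E suv au av]]] := sorted_insert sw' aw'.
  exists (u ++ a :: v); split=> //.
    by rewrite -cat1s perm_catCA /= perm_cons -w'E.
  move=> p; have M : l (values (it (p ++ u ++ a :: v)))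
      = sg K (par a && parity par u) *: l (values (it (p ++ a :: u ++ v))).
    have := Hit (p ++ u ++ a :: v); rewrite !it_cat => HH.
    by rewrite (move_to_front sw HH) parE -[_ :: it u ++ _]/(it [:: a] ++ (it u ++ it v)) -!it_cat.
  rewrite M -w'E -cat_rcons lw' scalerA cat_rcons; congr (_ * _ *: _).
  rewrite -(perm_big _ pw) w'E big_cat /= [X in _ = _ * X]big1_seq.
    rewrite mulr1 -big_filter (all_filterP au).
    elim: (u) => [|c b IHb] /=; first by rewrite big_nil andbF.
    by rewrite big_cons -IHb andb_addr /sg signr_addb.
  by move=> c /andP[ca cv]; rewrite (negPf (allP av _ cv)) in ca.
have un : uniq [seq sigma i | i <- enum 'I_N].
  by rewrite map_inj_uniq ?enum_uniq //; apply: perm_inj.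
have [w' [pw sw' lw']] := sortw _ un.
have w'E : w' = enum 'I_N.
  apply: (inj_map val_inj); apply: (irr_sorted_eq ltn_trans ltnn) => //.
    exact: sorted_enum_ord.
  apply: eq_mem_map => k; rewrite (perm_mem pw) mem_enum inE.
  by rewrite -[k](permKV sigma) map_f ?mem_enum.
have := lw' [::]; rewrite w'E /= koszulE.
have -> : values (it (enum 'I_N)) = permuted x 1%g.
  by rewrite /values /it -map_comp; apply: eq_map => k; rewrite /= perm1.
have E : values (it [seq sigma i | i <- enum 'I_N]) = permuted x sigma.
  rewrite /values /it /permuted -[LHS]map_comp -[LHS]map_comp.
  exact: eq_map.
by rewrite E.
Qed.

End GradedSymmetry.

(** * Reduction to sorted lists of pure elements *)

Section PureElements.
Variables (K : fieldType) (A B : lmodType K).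
Local Notation QB := (QB A B).
Local Notation gr := (@deg_QB K A B).
Implicit Types (qs : seq (nat * Q A B)) (fs : seq (nat * b A B)).
Implicit Types (es : seq (int * QB)).

(** An element of degree n in Q has degree n - 1 in Q[1]. *)
Definition itemQ (e : nat * Q A B) : int * QB := (e.1%:Z - 1, in1 e.2).
(** An element of degree n in b keeps its degree. *)
Definition itemb (e : nat * b A B) : int * QB := (e.1%:Z, in2 e.2).

Definition homQ qs := List.Forall (fun e : nat * Q A B => Qn e.1 e.2) qs.
Definition homb fs := List.Forall (fun e : nat * b A B => Homn e.1 e.2) fs.

Lemma QB_ext (x y : QB) :
  x.1 = y.1 :> (seq (A * B) -> A * B) -> x.2 = y.2 :> (seq B -> A) -> x = y.
Proof.
case: x y => [x1 x2] [y1 y2] /= E1 E2.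
by congr (_, _); apply: val_inj.
Qed.

Lemma deg_Q_sub d : is_subspace (deg_Q d : Q A B -> Prop).
Proof.
case: d => n /=; last by split=> // a x y -> ->; rewrite scaler0 addr0.
have [H0 HD] := @Qn_submod K A B n; split=> // a x y Hx Hy.
exact: (HD a _ _ Hx Hy).
Qed.

Lemma deg_b_sub d : is_subspace (deg_b d : b A B -> Prop).
Proof.
case: d => n /=; last by split=> // a x y -> ->; rewrite scaler0 addr0.
have [H0 HD] := @Homn_submod K B A n; split=> // a x y Hx Hy.
exact: (HD a _ _ Hx Hy).
Qed.

Lemma deg_QB_sub d : is_subspace (gr d).
Proof.
split; first by split; [case: (deg_Q_sub (d + 1))|case: (deg_b_sub d)].
move=> a x y [x1 x2] [y1 y2]; split.
  by case: (deg_Q_sub (d + 1)) => _; apply.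
by case: (deg_b_sub d) => _; apply.
Qed.

Lemma in1_0 : in1 (0 : Q A B) = 0 :> QB.
Proof. by []. Qed.

Lemma in2_0 : in2 (0 : b A B) = 0 :> QB.
Proof. by []. Qed.

Lemma QB_split (x : QB) : x = in1 x.1 + in2 x.2.
Proof.
by case: x => F f; rewrite /in1 /in2 -[RHS]/(F + 0, 0 + f) addr0 add0r.
Qed.

Lemma hom_itemQ (e : nat * Q A B) : Qn e.1 e.2 -> homogeneous gr (itemQ e).
Proof.
by move=> He; split; [rewrite /= subrK|case: (deg_b_sub (itemQ e).1)].
Qed.

Lemma hom_itemb (e : nat * b A B) : Homn e.1 e.2 -> homogeneous gr (itemb e).
Proof. by move=> He; split; [case: (deg_Q_sub ((itemb e).1 + 1))|]. Qed.

Lemma hom_itemsQ qs : homQ qs -> List.Forall (homogeneous gr) (map itemQ qs).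
Proof.
elim: qs => [|e qs IH] /=; first by constructor.
by case/List.Forall_cons_iff=> /hom_itemQ He /IH; constructor.
Qed.

Lemma hom_itemsb fs : homb fs -> List.Forall (homogeneous gr) (map itemb fs).
Proof.
elim: fs => [|e fs IH] /=; first by constructor.
by case/List.Forall_cons_iff=> /hom_itemb He /IH; constructor.
Qed.

Lemma hom_items qs fs : homQ qs -> homb fs ->
  List.Forall (homogeneous gr) (map itemQ qs ++ map itemb fs).
Proof.
by move=> /hom_itemsQ Hq /hom_itemsb Hf; apply/List.Forall_app.
Qed.

(** A property of lists of homogeneous elements that is additive in each entry
    and invariant under adjacent transpositions only needs to be checked on
    lists of elements of Q followed by elements of b. *)
Lemma pure_sorted_ind (R : seq (int * QB) -> Prop) :
  (forall s d x y t, R (s ++ (d, x) :: t) -> R (s ++ (d, y) :: t) ->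
     R (s ++ (d, x + y) :: t)) ->
  (forall s d t, R (s ++ (d, 0) :: t)) ->
  (forall s x y t, List.Forall (homogeneous gr) (s ++ x :: y :: t) ->
     R (s ++ x :: y :: t) -> R (s ++ y :: x :: t)) ->
  (forall qs fs, homQ qs -> homb fs -> R (map itemQ qs ++ map itemb fs)) ->
  forall es, List.Forall (homogeneous gr) es -> R es.
Proof.
move=> Radd R0 Rswap Rpure es Hes.
have Rmove p e u v : List.Forall (homogeneous gr) (p ++ e :: u ++ v) ->
    R (p ++ e :: u ++ v) -> R (p ++ u ++ e :: v).
  elim: u p => [|c u IH] p //= H Rp; rewrite -cat_rcons; apply: IH.
    rewrite cat_rcons; move: H.
    by rewrite !(List.Forall_app, List.Forall_cons_iff); tauto.
  by rewrite cat_rcons; apply: Rswap.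
suff main qs fs : homQ qs -> homb fs ->
    R (map itemQ qs ++ map itemb fs ++ es).
  exact: (main [::] [::]).
elim: es Hes qs fs => [_ qs fs Hq Hf|[d x] es IH]; first by rewrite cats0; apply: Rpure.
move=> /List.Forall_cons_iff[[/= xQ xb] Hes] qs fs Hq Hf.
rewrite [x]QB_split catA; apply: (Radd); rewrite -catA.
  case En: (d + 1) xQ => [n|n] /= xQ; last by rewrite xQ in1_0 catA; apply: R0.
  have E : (d, in1 x.1) = itemQ (n, x.1) by rewrite /itemQ /= -En addrK.
  have Hq' : homQ (rcons qs (n, x.1)) by apply: Forall_rcons.
  rewrite E; apply: Rmove; last first.
    by have := IH Hes _ _ Hq' Hf; rewrite map_rcons cat_rcons.
  have := hom_items Hq' Hf; rewrite map_rcons cat_rcons.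
  by rewrite !(List.Forall_app, List.Forall_cons_iff); tauto.
case: d xb {xQ} => n /= xb; last by rewrite xb in2_0 catA; apply: R0.
have Hf' : homb (rcons fs (n, x.2)) by apply: Forall_rcons.
by have := IH Hes _ _ Hq Hf'; rewrite map_rcons cat_rcons.
Qed.

End PureElements.

Arguments itemQ {K A B} e.
Arguments itemb {K A B} e.

(** * The generalized Jacobi identities *)

Section Brackets.
Variables (K : fieldType) (A B : lmodType K).
Local Notation QB := (QB A B).
Local Notation gr := (@deg_QB K A B).
Local Notation funV := (seq (A * B) -> A * B).
Local Notation funB := (seq B -> A).
Variable l : seq QB -> QB.
Hypothesis Hl : is_ltilde l.
Implicit Types (qs : seq (nat * Q A B)) (fs : seq (nat * b A B)).
Implicit Types (es : seq (int * QB)).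

Lemma ltilde_swap : swap_symmetric gr l.
Proof. exact: graded_symmetric_swap (ltilde_symmetric Hl). Qed.

Lemma ltilde_zero (Fs : seq (Q A B)) (gs : seq (b A B)) :
  (0 < size Fs + size gs)%N -> ~~ ((size Fs == 2) && (size gs == 0)) ->
  ~~ ((size Fs == 1) && (0 < size gs)%N) -> l (map (@in1 K A B) Fs ++ map (@in2 K A B) gs) = 0.
Proof.
move=> s0 s2 s1; have := @ltilde_0 _ _ _ _ Hl (map inl Fs ++ map inr gs).
have -> : [seq match t with inl F => in1 F | inr f => in2 f end
     | t <- map inl Fs ++ map inr gs] = map (@in1 K A B) Fs ++ map (@in2 K A B) gs :> seq QB.
  by rewrite map_cat -!map_comp.
rewrite count_cat !count_map /= [X in (X + _)%N](@eq_count _ _ predT) //.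
rewrite [X in (_ + X)%N](@eq_count _ _ pred0) // count_predT count_pred0 addn0.
by rewrite size_cat !size_map => H; apply: H; lia.
Qed.

(** Elements of b with their degrees, seen as plain functions. *)
Definition raw fs : seq (nat * funB) := [seq (e.1, bval e.2) | e <- fs].

Lemma hom_raw fs : homb fs -> homogeneous_list (raw fs).
Proof.
elim: fs => [|e fs IH] /=; first by constructor.
by case/List.Forall_cons_iff=> He /IH; constructor.
Qed.

Lemma iter_bracketE (F : Q A B) fs :
  iter_bracket F [seq e.2 | e <- fs] = itb F [seq e.2 | e <- raw fs].
Proof.
rewrite /iter_bracket /itb; elim: fs (Qval F) => //= e fs IH G; exact: IH.
Qed.

Lemma values_items qs fs : values (map itemQ qs ++ map itemb fs)
  = map (@in1 K A B) [seq e.2 | e <- qs] ++ map (@in2 K A B) [seq e.2 | e <- fs].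
Proof. by rewrite /values map_cat -!map_comp. Qed.

Lemma ltilde_Qbs n (F : Q A B) fs : Qn n F -> (0 < size fs)%N ->
  (l (in1 F :: values (map itemb fs))).1 = 0
  /\ (l (in1 F :: values (map itemb fs))).2
     = P (itb F [seq e.2 | e <- raw fs]) :> funB.
Proof.
move=> HF fs0; have := @ltilde_Qb _ _ _ _ Hl n F [seq e.2 | e <- fs] HF.
by rewrite size_map iter_bracketE -map_comp /values -map_comp; apply.
Qed.

Lemma ltilde_sorted0 qs fs : (0 < size qs + size fs)%N ->
  ~~ ((size qs == 2) && (size fs == 0)) -> ~~ ((size qs == 1) && (0 < size fs)%N) ->
  l (values (map itemQ qs ++ map itemb fs)) = 0.
Proof. by move=> *; rewrite values_items; apply: ltilde_zero; rewrite !size_map. Qed.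

Definition degrees es : int := \sum_(e <- es) e.1.

Lemma degrees_itemb fs : degrees (map itemb fs) = (total_degree (raw fs))%:Z.
Proof.
rewrite /degrees; elim: fs => [|e fs IH] /=; first by rewrite big_nil.
by rewrite big_cons IH.
Qed.

(** The brackets have degree 1. *)
Lemma ltilde_degree es : List.Forall (homogeneous gr) es -> (0 < size es)%N ->
  gr (degrees es + 1) (l (values es)).
Proof.
pose R es := (0 < size es)%N -> gr (degrees es + 1) (l (values es)).
have LL := ltilde_multilinear Hl.
apply: (@pure_sorted_ind _ _ _ R) => {es} [s d x y t|s d t _|s x y t Hs|qs fs].
- rewrite /R /degrees /values !size_cat !map_cat /= !big_cat !big_cons /=.
  rewrite multilinearD // => Hx Hy s0.
  apply: subspaceD; [exact: deg_QB_sub|exact: Hx|exact: Hy].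
- rewrite /values map_cat /= multilinear0 //.
  by apply: subspace0; apply: deg_QB_sub.
- rewrite /R !size_cat /= => Hx s0; rewrite ltilde_swap; last first.
    by move: Hs; rewrite !(List.Forall_app, List.Forall_cons_iff); tauto.
  apply: subspaceZ; first exact: deg_QB_sub.
  have -> : degrees (s ++ y :: x :: t) = degrees (s ++ x :: y :: t).
    by rewrite /degrees !big_cat !big_cons /= (addrCA y.1).
  exact: Hx.
move=> Hq Hf; rewrite /R size_cat !size_map => s0.
have [/andP[/eqP s2 /eqP f0]|n2] := boolP ((size qs == 2) && (size fs == 0)).
  case: qs s2 Hq {s0} => [|[n F] [|[m G] []]] // _.
  rewrite (size0nil f0) cats0.
  case/List.Forall_cons_iff=> /= HF /List.Forall_cons_iff[/= HG _].
  have [E1 E2] := @ltilde_QQ _ _ _ _ Hl n m F G HF HG.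
  have -> : degrees (map itemQ [:: (n, F); (m, G)]) + 1 = (n + m)%:Z - 1.
    by rewrite /degrees /= !big_cons big_nil /= PoszD; lia.
  split; last by rewrite E2; apply: subspace0; apply: deg_b_sub.
  rewrite subrK /= E1; have [HF' PF] := (QnE n F).1 HF; have [HG' PG] := (QnE m G).1 HG.
  apply: subspaceZ; first exact: Qn_submod.
  by apply/QnE; split; [apply: Homn_bracket|apply: P_bracket].
have [/andP[/eqP s1 f0]|n1] := boolP ((size qs == 1) && (0 < size fs)%N).
  case: qs s1 Hq {s0 n2} => [|[n F] []] // _ /List.Forall_cons_iff[/= HF _].
  have [E1 E2] := ltilde_Qbs HF f0.
  have -> : degrees (itemQ (n, F) :: map itemb fs) + 1
      = (n + total_degree (raw fs))%:Z.
    by rewrite /degrees big_cons -/(degrees _) degrees_itemb /= PoszD; lia.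
  split; first by rewrite E1; apply: subspace0; apply: deg_Q_sub.
  rewrite /= E2; apply/P_Homn/Homn_itb; last exact: hom_raw.
  by have [] := (QnE n F).1 HF.
rewrite ltilde_sorted0 //.
by apply: subspace0; apply: deg_QB_sub.
Qed.

End Brackets.

Section Jacobi.
Variables (K : fieldType) (A B : lmodType K).
Local Notation QB := (QB A B).
Local Notation gr := (@deg_QB K A B).
Local Notation funV := (seq (A * B) -> A * B).
Local Notation funB := (seq B -> A).
Variable l : seq QB -> QB.
Hypothesis Hl : is_ltilde l.
Implicit Types (qs : seq (nat * Q A B)) (fs : seq (nat * b A B)).
Implicit Types (es s t u v w : seq (int * QB)).

(** The general term of the generalized Jacobi identity; an empty inner
    bracket does not occur in it, hence the value 0. *)
Definition nested s t : QB :=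
  if s is [::] then 0 else l (l (values s) :: values t).

(** The left-hand side of the generalized Jacobi identity, as a sum over
    unshuffles. *)
Definition jacobiator es : QB :=
  unshuffle (@item_parity K QB) nested [::] [::] es.

Let LL : multilinear l := ltilde_multilinear Hl.
Let LS : swap_symmetric gr l := ltilde_swap Hl.

Lemma nested_addl d (x y : QB) u v w :
  nested (u ++ (d, x + y) :: v) w
  = nested (u ++ (d, x) :: v) w + nested (u ++ (d, y) :: v) w.
Proof.
have E z : nested (u ++ (d, z) :: v) w = l (l (values (u ++ (d, z) :: v)) :: values w).
  by case: u.
rewrite !E /values !map_cat /= multilinearD //.
exact: (multilinearD [::]).
Qed.

Lemma nested_addr d (x y : QB) u v w :
  nested w (u ++ (d, x + y) :: v)
  = nested w (u ++ (d, x) :: v) + nested w (u ++ (d, y) :: v).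
Proof.
case: w => [|e w]; first by rewrite /= addr0.
by rewrite /= /values !map_cat /= -!cat_cons multilinearD.
Qed.

Lemma jacobiator_add s d (x y : QB) t :
  jacobiator (s ++ (d, x + y) :: t)
  = jacobiator (s ++ (d, x) :: t) + jacobiator (s ++ (d, y) :: t).
Proof. by apply: unshuffle_add => // *; [apply: nested_addl|apply: nested_addr]. Qed.

Lemma jacobiator_swap s x y t :
  List.Forall (homogeneous gr) (s ++ x :: y :: t) ->
  jacobiator (s ++ x :: y :: t)
  = sg K (item_parity x && item_parity y) *: jacobiator (s ++ y :: x :: t).
Proof.
apply: (@unshuffle_swap _ _ _ _ (homogeneous gr)) => //.
- move=> u a c v w Hu _.
  have E a' c' : nested (u ++ a' :: c' :: v) w
      = l (l (values (u ++ a' :: c' :: v)) :: values w) by case: u {Hu}.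
  by rewrite !E LS // (multilinearZ [::]).
- move=> u a c v [|e w] Hu Hw; first by rewrite /= scaler0.
  have Hlw : homogeneous gr (degrees (e :: w) + 1, l (values (e :: w))).
    exact: ltilde_degree.
  have H : List.Forall (homogeneous gr)
      ((degrees (e :: w) + 1, l (values (e :: w))) :: u ++ a :: c :: v).
    by constructor.
  exact: (LS (s := (degrees (e :: w) + 1, l (values (e :: w))) :: u) H).
Qed.

Lemma ltilde_zero_b (h : b A B) qs fs : (size qs != 1)%N ->
  (0 < size qs + size fs)%N -> l (in2 h :: values (map itemQ qs ++ map itemb fs)) = 0.
Proof.
move=> s1 s0; have := @ltilde_0 _ _ _ _ Hl
  (inr h :: map inl [seq e.2 | e <- qs] ++ map inr [seq e.2 | e <- fs]).
rewrite /= map_cat -!map_comp values_items -!map_comp.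
rewrite count_cat !count_map add0n /= [X in (X + _)%N](@eq_count _ _ predT) //.
rewrite [X in (_ + X)%N](@eq_count _ _ pred0) // count_predT count_pred0 addn0.
by rewrite size_cat !size_map => H; apply: H; lia.
Qed.

Lemma ltilde_QQE (e1 e2 : nat * Q A B) : Qn e1.1 e1.2 -> Qn e2.1 e2.2 ->
  exists H : Q A B, l [:: in1 e1.2; in1 e2.2] = in1 H
    /\ H = (-1) ^+ e1.1 *: bracket e1.2 e2.2 :> funV.
Proof.
move=> H1 H2; have [E1 E2] := @ltilde_QQ _ _ _ _ Hl _ _ _ _ H1 H2.
exists (l [:: in1 e1.2; in1 e2.2]).1; split=> //.
by rewrite [LHS]QB_split E2 in2_0 addr0.
Qed.

Lemma ltilde_QbsE (e : nat * Q A B) fs : Qn e.1 e.2 -> (0 < size fs)%N ->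
  exists h : b A B, l (in1 e.2 :: values (map itemb fs)) = in2 h
    /\ h = P (itb e.2 [seq e.2 | e <- raw fs]) :> funB.
Proof.
move=> He f0; have [E1 E2] := ltilde_Qbs Hl He f0.
exists (l (in1 e.2 :: values (map itemb fs))).2; split=> //.
by rewrite [LHS]QB_split E1 in1_0 add0r.
Qed.

(** Only the terms with two elements of Q, or with three and no others, can
    fail to vanish. *)
Lemma nested_vanish q1 q2 f1 f2 : homQ q1 ->
  (size q1 + size q2 != 2)%N ->
  (size q1 + size q2 != 3)%N || (0 < size f1 + size f2)%N ->
  nested (map itemQ q1 ++ map itemb f1) (map itemQ q2 ++ map itemb f2) = 0.
Proof.
move=> Hq n2 n3; have cons_in1 (H : Q A B) : in1 H :: values (map itemQ q2 ++ map itemb f2)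
    = values (map itemQ ((0%N, H) :: q2) ++ map itemb f2) by [].
have [s0|s0] := posnP (size q1 + size f1)%N.
  by have [/size0nil-> /size0nil->] : size q1 = 0%N /\ size f1 = 0%N by lia.
have -> : nested (map itemQ q1 ++ map itemb f1) (map itemQ q2 ++ map itemb f2)
    = l (l (values (map itemQ q1 ++ map itemb f1))
           :: values (map itemQ q2 ++ map itemb f2)).
  by case: (q1) s0 => //; case: (f1).
have l0 (ys : seq QB) : l (0 :: ys) = 0 by apply: (multilinear0 [::]).
have [/andP[/eqP q1s /eqP f1s]|n20] := boolP ((size q1 == 2) && (size f1 == 0)).
  case: q1 q1s n2 n3 Hq {s0} => [|e1 [|e2 []]] // _ n2 n3.
  case/List.Forall_cons_iff=> H1 /List.Forall_cons_iff[H2 _].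
  rewrite (size0nil f1s) in n3 *.
  have [H [-> _]] := ltilde_QQE H1 H2; rewrite cons_in1.
  by apply: (ltilde_sorted0 Hl) => /=; move: n2 n3 => /=; lia.
have [/andP[/eqP q1s f1s]|n11] := boolP ((size q1 == 1) && (0 < size f1)%N); last first.
  by rewrite (ltilde_sorted0 Hl).
case: q1 q1s {s0 n20} n2 n3 Hq => [|e1 []] // _ n2 n3 /List.Forall_cons_iff[H1 _].
have [h [-> _]] := ltilde_QbsE H1 f1s.
have [s0|s0] := posnP (size q2 + size f2)%N; last first.
  by apply: ltilde_zero_b => //; move: n2 => /=; lia.
have [/size0nil-> /size0nil->] : size q2 = 0%N /\ size f2 = 0%N by lia.
exact: (ltilde_sorted0 Hl (qs := [::]) (fs := [:: (0%N, h)])).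
Qed.

Lemma unshuffle_vanish_b q1 q2 f1 f2 fs : homQ q1 ->
  (size q1 + size q2 != 2)%N ->
  (size q1 + size q2 != 3)%N || (0 < size f1 + size f2 + size fs)%N ->
  unshuffle (@item_parity K QB) nested (map itemQ q1 ++ map itemb f1)
    (map itemQ q2 ++ map itemb f2) (map itemb fs) = 0.
Proof.
move=> Hq n2; elim: fs f1 f2 => [|e fs IH] f1 f2 n3 /=.
  by apply: nested_vanish => //; rewrite addn0 in n3.
rewrite !rcons_cat -!map_rcons !IH ?scaler0 ?addr0 // size_rcons; move: n3 => /=; lia.
Qed.

Lemma unshuffle_vanish q1 q2 qs fs : homQ q1 -> homQ qs ->
  (size q1 + size q2 + size qs != 2)%N ->
  (size q1 + size q2 + size qs != 3)%N || (0 < size fs)%N ->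
  unshuffle (@item_parity K QB) nested (map itemQ q1) (map itemQ q2)
    (map itemQ qs ++ map itemb fs) = 0.
Proof.
elim: qs q1 q2 => [|e qs IH] q1 q2 Hq1 Hqs n2 n3 /=.
  have := @unshuffle_vanish_b q1 q2 [::] [::] fs; rewrite /= !cats0; apply=> //.
    by rewrite addn0 in n2.
  by rewrite addn0 in n3.
case/List.Forall_cons_iff: Hqs => He Hqs.
have Hq1' : homQ (rcons q1 e) by apply: Forall_rcons.
by rewrite -!map_rcons !IH ?scaler0 ?addr0 ?size_rcons //; move: n2 n3 => /=; lia.
Qed.

End Jacobi.

Section JacobiIdentity.
Variables (K : fieldType) (A B : lmodType K).
Local Notation QB := (QB A B).
Local Notation gr := (@deg_QB K A B).
Local Notation funV := (seq (A * B) -> A * B).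
Local Notation funB := (seq B -> A).

Lemma item_parityQ (e : nat * Q A B) : item_parity (itemQ e) = ~~ odd e.1.
Proof.
case: e => [[|n] F] //; rewrite /item_parity /= negbK.
by congr (odd _); lia.
Qed.

Lemma item_parityb (e : nat * b A B) : item_parity (itemb e) = odd e.1.
Proof. by []. Qed.

(** Iterated brackets with elements of b satisfy the Leibniz rule. *)
Lemma itb_bracket n m (F G : funV) (a1 a2 fs : seq (nat * funB)) :
  Homn n F -> Homn m G ->
  homogeneous_list a1 -> homogeneous_list a2 -> homogeneous_list fs ->
  unshuffle (fun e : nat * funB => odd e.1)
    (fun s t => (-1) ^+ (m * total_degree s) *:
       bracket (itb F [seq e.2 | e <- s]) (itb G [seq e.2 | e <- t])) a1 a2 fs
  = (-1) ^+ (m * total_degree a1) *: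
    itb (bracket (itb F [seq e.2 | e <- a1]) (itb G [seq e.2 | e <- a2]))
      [seq e.2 | e <- fs].
Proof.
move=> HF HG; elim: fs a1 a2 => [|e fs IH] a1 a2 H1 H2 //=.
case/List.Forall_cons_iff=> He Hfs.
have H1' : homogeneous_list (rcons a1 e) by apply: Forall_rcons.
have H2' : homogeneous_list (rcons a2 e) by apply: Forall_rcons.
have par_total (s : seq (nat * funB)) : parity (fun e : nat * funB => odd e.1) s
    = odd (total_degree s).
  by elim: s => //= c s ->; rewrite oddD.
rewrite !IH // par_total.
rewrite (bracket_jacobi (Homn_itb HF H1) (Homn_itb HG H2) (ext0_Homn He)).
have fsL := homogeneous_multilinear Hfs.
rewrite -[bracket _ (bracket _ (ext0 _))]scale1r itb_linear // itbZ //.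
rewrite -!cats1 !map_cat /= !itb_cat /= /total_degree map_cat sumn_cat /=.
rewrite /sg.
rewrite addn0; sign_cases; lin_ring K (seq (A * B) -> A * B)%type.
Qed.

Section Identity.
Variable l : seq QB -> QB.
Hypothesis Hl : is_ltilde l.
Implicit Types (qs : seq (nat * Q A B)) (fs : seq (nat * b A B)).

(** For three elements of Q the generalized Jacobi identity is the graded Jacobi
    identity of the Gerstenhaber bracket. *)
Lemma jacobiator_QQQ (e1 e2 e3 : nat * Q A B) :
  Qn e1.1 e1.2 -> Qn e2.1 e2.2 -> Qn e3.1 e3.2 ->
  jacobiator l [:: itemQ e1; itemQ e2; itemQ e3] = 0.
Proof.
move=> H1 H2 H3; rewrite /jacobiator /=.
have l0 (ys : seq QB) : l (0 :: ys) = 0.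
  exact: (multilinear0 [::] _ (ltilde_multilinear Hl)).
have l1 (F : Q A B) : l [:: in1 F] = 0.
  exact: (ltilde_sorted0 Hl (qs := [:: (0%N, F)]) (fs := [::])).
have l3 (F G H : Q A B) : l [:: in1 F; in1 G; in1 H] = 0.
  exact: (ltilde_sorted0 Hl (qs := [:: (0%N, F); (0%N, G); (0%N, H)]) (fs := [::])).
rewrite !l1 !l3 !l0 !scaler0 !addr0 !add0r.
have HQ2 (c1 c2 c3 : nat * Q A B) :
   Qn c1.1 c1.2 -> Qn c2.1 c2.2 -> Qn c3.1 c3.2 ->
   exists H : Q A B, l [:: l [:: in1 c1.2; in1 c2.2]; in1 c3.2] = in1 H
     /\ H = (-1) ^+ c2.1 *: bracket (bracket c1.2 c2.2) c3.2 :> funV.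
  move=> C1 C2 C3; have [H [-> HE]] := ltilde_QQE Hl C1 C2.
  have [[HC1 P1] [HC2 P2]] := (((QnE _ _).1 C1), ((QnE _ _).1 C2)).
  have HH : Qn (c1.1 + c2.1) H.
    rewrite HE; apply: subspaceZ; first exact: Qn_submod.
    by apply/QnE; split; [apply: Homn_bracket|apply: P_bracket].
  have [H' [HE' E']] := ltilde_QQE Hl (e1 := (_, H)) HH C3.
  exists H'; split=> //; rewrite E' /= HE.
  have [HC3 _] := (QnE _ _).1 C3.
  rewrite (bracketZl _ _ (proj1 HC3)).
  by sign_cases; lin_ring K (seq (A * B) -> A * B)%type.
have [h1 [-> E1]] := HQ2 _ _ _ H1 H2 H3.
have [h2 [-> E2]] := HQ2 _ _ _ H1 H3 H2.
have [h3 [-> E3]] := HQ2 _ _ _ H2 H3 H1.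
have [[HF _] [HG _] [HH _]] := And3 ((QnE _ _).1 H1) ((QnE _ _).1 H2) ((QnE _ _).1 H3).
rewrite !item_parityQ !andbF !addbF; apply: QB_ext; last first.
  by rewrite /= !(scaler0, addr0).
transitivity (sg K false *: (sg K false *: (h1 : funV)
    + sg K (~~ odd e3.1 && ~~ odd e2.1) *: (h2 : funV))
  + sg K (~~ odd e2.1 && ~~ odd e1.1) *: (sg K (~~ odd e3.1 && ~~ odd e1.1)
    *: (h3 : funV))) => //.
rewrite {}E1 {}E2 {}E3 (bracketC (Homn_bracket HG HH) HF) (bracket_jacobi HF HG HH).
by rewrite /sg; sign_cases; lin_ring K (seq (A * B) -> A * B)%type.
Qed.

End Identity.
End JacobiIdentity.

Section JacobiIdentityQQ.
Variables (K : fieldType) (A B : lmodType K).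
Local Notation QB := (QB A B).
Local Notation gr := (@deg_QB K A B).
Local Notation funV := (seq (A * B) -> A * B).
Local Notation funB := (seq B -> A).
Variable l : seq QB -> QB.
Hypothesis Hl : is_ltilde l.
Implicit Types (qs : seq (nat * Q A B)) (fs : seq (nat * b A B)).

Lemma bval2Z (c : K) (x : QB) : bval (c *: x).2 = c *: bval x.2.
Proof. by []. Qed.

Lemma bval2D (x y : QB) : bval (x + y).2 = bval x.2 + bval y.2.
Proof. by []. Qed.

(** The inner bracket vanishes without entries in Q. *)
Lemma unshuffle_no_Q f1 t fs :
  unshuffle (@item_parity K QB) (nested l) (map itemb f1) t (map itemb fs) = 0.
Proof.
elim: fs f1 t => [|e fs IH] f1 t /=; last by rewrite -map_rcons !IH scaler0 addr0.
case: f1 => // e f1; rewrite /=.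
have -> : l (in2 e.2 :: values (map itemb f1)) = 0.
  exact: (ltilde_sorted0 Hl (qs := [::]) (fs := e :: f1)).
by rewrite (multilinear0 [::] _ (ltilde_multilinear Hl)).
Qed.

(** With two elements of Q, the inner bracket has no other entry. *)
Lemma unshuffle_QQ_first (e1 e2 : nat * Q A B) f2 fs :
  unshuffle (@item_parity K QB) (nested l) [:: itemQ e1; itemQ e2] (map itemb f2)
    (map itemb fs)
  = nested l [:: itemQ e1; itemQ e2] (map itemb (f2 ++ fs)).
Proof.
have vanish c f1 t gs : unshuffle (@item_parity K QB) (nested l)
    (map itemQ [:: e1; e2] ++ map itemb (c :: f1)) t (map itemb gs) = 0.
  elim: gs f1 t => [|e gs IH] f1 t /=; last first.
    by have := IH (rcons f1 e); rewrite /= map_rcons => E; rewrite E IH scaler0 addr0.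
  have -> : l [:: in1 e1.2, in1 e2.2, in2 c.2 & values (map itemb f1)] = 0.
    exact: (ltilde_sorted0 Hl (qs := [:: e1; e2]) (fs := c :: f1)).
  by rewrite (multilinear0 [::] _ (ltilde_multilinear Hl)).
elim: fs f2 => [|e fs IH] f2; first by rewrite cats0.
by rewrite [LHS]/= (vanish e [::]) scaler0 add0r -map_rcons IH cat_rcons.
Qed.

Lemma parity_itemb (s : seq (nat * b A B)) :
  parity (@item_parity K QB) (map itemb s) = odd (total_degree (raw s)).
Proof. by elim: s => //= c s ->; rewrite oddD. Qed.

(** The value of a nested bracket, with the inner result moved to the end. *)
Lemma nested_Q_Q (e1 e2 : nat * Q A B) s t :
  Qn e1.1 e1.2 -> Qn e2.1 e2.2 -> homb s -> homb t ->
  (nested l (itemQ e1 :: map itemb s) (itemQ e2 :: map itemb t)).1 = 0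
  /\ (nested l (itemQ e1 :: map itemb s) (itemQ e2 :: map itemb t)).2
  = (-1) ^+ ((e1.1 + total_degree (raw s)) * e2.1.+1) *:
    ((-1) ^+ ((e1.1 + total_degree (raw s)) * total_degree (raw t)) *:
     P (bracket (itb e2.2 [seq e.2 | e <- raw t])
        (ext0 (P (itb e1.2 [seq e.2 | e <- raw s]))))) :> funB.
Proof.
move=> H1 H2 Hs Ht; have [[HF PF] [HG PG]] := (((QnE _ _).1 H1), ((QnE _ _).1 H2)).
have HX := Homn_itb HF (hom_raw Hs); have HY := Homn_itb HG (hom_raw Ht).
have HPX := P_Homn HX.
case: s Hs HX HPX => [|c s] Hs HX HPX.
  rewrite /= (ltilde_sorted0 Hl (qs := [:: e1]) (fs := [::])) //.
  rewrite (multilinear0 [::] _ (ltilde_multilinear Hl)) PF; split=> //.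
  have -> : ext0 (0 : funB) = 0 by [].
  rewrite (bracket0r (proj1 HY)).
  by rewrite [P 0](_ : _ = 0) // !scaler0.
have [h [lh hE]] := ltilde_QbsE Hl H1 (isT : 0 < size (c :: s))%N.
rewrite -[nested _ _ _]/(l (l (in1 e1.2 :: values (map itemb (c :: s)))
  :: in1 e2.2 :: values (map itemb t))) lh.
pose eh := (e1.1 + total_degree (raw (c :: s)), h)%N.
have Hh : Homn eh.1 eh.2 by rewrite /= hE.
have Hth : homb (eh :: t) by constructor.
have := ltilde_swap Hl (s := [::]) (x := itemb eh) (y := itemQ e2) (t := map itemb t).
rewrite /= => ->; last first.
  constructor; first exact: hom_itemb.
  by constructor; [exact: hom_itemQ|exact: hom_itemsb].
have [h' [lh' hE']] := ltilde_QbsE Hl H2 (isT : 0 < size (eh :: t))%N.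
rewrite lh'; split; first by rewrite /= scaler0.
rewrite -[LHS]/(sg K _ *: (h' : funB)) hE' item_parityb item_parityQ.
have M := itb_move HG (hom_raw Ht) (e := (eh.1, bval h)) Hh (List.Forall_nil _).
rewrite /= cats0 itb_cat /= in M.
rewrite -hE M -[P (_ *: itb _ _)]/(_ *: P (itb _ _)).
rewrite [eh.1]/= [raw (eh :: t)]/= /= /sg.
by sign_cases; lin_ring K (seq B -> A)%type.
Qed.

(** The generalized Jacobi identity for two elements F, G of Q and elements of b.
    By the Leibniz rule the terms P [..[[F, G], f_1], .., f_m] are a sum of
    terms P [X, Y], where X and Y are iterated brackets of F and of G with
    complementary sublists. As P [X, Y] = P [P X, Y] + P [X, P Y], they cancel
    against the terms in which F, respectively G, is in the inner bracket. *)
Lemma jacobiator_QQ (e1 e2 : nat * Q A B) fs : Qn e1.1 e1.2 -> Qn e2.1 e2.2 ->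
  homb fs -> jacobiator l [:: itemQ e1, itemQ e2 & map itemb fs] = 0.
Proof.
move=> H1 H2 Hf; have [[HF PF] [HG PG]] := (((QnE _ _).1 H1), ((QnE _ _).1 H2)).
rewrite /jacobiator /= (unshuffle_no_Q [::]) (unshuffle_QQ_first _ _ [::]) addr0.
rewrite !andbF /= addbF !item_parityQ.
pose X s := itb e1.2 [seq e.2 | e <- raw s]; pose Y s := itb e2.2 [seq e.2 | e <- raw s].
pose U (Phi : seq (nat * b A B) -> seq (nat * b A B) -> QB) :=
  unshuffle (fun e : nat * b A B => odd e.1) Phi [::] [::] fs.
pose U' (Phi : seq (nat * b A B) -> seq (nat * b A B) -> funB) :=
  unshuffle (fun e : nat * b A B => odd e.1) Phi [::] [::] fs.
(* The terms with a in the inner bracket and c in the outer one. *)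
have prefix (a c : nat * Q A B) :
    unshuffle (@item_parity K QB) (nested l) [:: itemQ a] [:: itemQ c] (map itemb fs)
    = U (fun s t => sg K (~~ odd c.1 && odd (total_degree (raw s)))
          *: nested l (itemQ a :: map itemb s) (itemQ c :: map itemb t)).
  have := unshuffle_prefix (@item_parity K QB) [:: itemQ a] [:: itemQ c]
    (nested l) [::] [::] (map itemb fs).
  rewrite andbF scale1r => <-; rewrite (unshuffle_comap _ _ _ [::] [::]).
  apply: unshuffle_eq => s t; congr (_ *: _).
  by rewrite parity_itemb /= addbF item_parityQ.
have par_raw w : parity (fun e : nat * b A B => odd e.1) w = odd (total_degree (raw w)).
  by elim: w => //= c w ->; rewrite oddD.
(* Relabelling: in both sums s shall be the list that accompanies e1. *)
have exch : U (fun s t => sg K (~~ odd e1.1 && odd (total_degree (raw s)))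
          *: nested l (itemQ e2 :: map itemb s) (itemQ e1 :: map itemb t))
   = U (fun s t => sg K (odd (total_degree (raw s)) && odd (total_degree (raw t))) *:
         (sg K (~~ odd e1.1 && odd (total_degree (raw t)))
          *: nested l (itemQ e2 :: map itemb t) (itemQ e1 :: map itemb s))).
  rewrite /U -[LHS]scale1r -[1]/(sg K (parity (fun e : nat * b A B => odd e.1) [::] &&
     parity (fun e : nat * b A B => odd e.1) [::])) -unshuffle_exchange.
  by apply: unshuffle_eq => s t; rewrite !par_raw.
rewrite !prefix {}exch.
set c3 := sg K (~~ odd e2.1 && ~~ odd e1.1).
have [E1 E2] : (l (l [:: in1 e1.2; in1 e2.2] :: values [seq itemb i | i <- fs])).1 = 0
  /\ (l (l [:: in1 e1.2; in1 e2.2] :: values [seq itemb i | i <- fs])).2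
  = (-1) ^+ e1.1 *: U' (fun s t => (-1) ^+ (e2.1 * total_degree (raw s)) *:
      P (bracket (X s) (Y t))) :> funB.
  have [H [-> HE]] := ltilde_QQE Hl H1 H2.
  have HH : Qn (e1.1 + e2.1) H.
    rewrite HE; apply: subspaceZ; first exact: Qn_submod.
    by apply/QnE; split; [apply: Homn_bracket|apply: P_bracket].
  have Leib : U' (fun s t => (-1) ^+ (e2.1 * total_degree (raw s)) *:
      P (bracket (X s) (Y t))) = P (itb (bracket e1.2 e2.2) [seq e.2 | e <- raw fs]).
    have hr := hom_raw Hf.
    have := itb_bracket HF HG (List.Forall_nil _) (List.Forall_nil _) hr.
    rewrite muln0 expr0 scale1r => /= <-.
    rewrite (@unshuffle_map _ _ _ _ _ (@P K A B)) //.
    by rewrite (unshuffle_comap _ (fun e : nat * b A B => (e.1, bval e.2)) _ [::] [::]).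
  rewrite Leib; case: (fs) Hf => [|c gs] Hf'.
    rewrite /= P_bracket // scaler0.
    by have -> : l [:: in1 H] = 0 by exact: (ltilde_sorted0 Hl (qs := [:: (0%N, H)]) (fs := [::])).
  have [h [-> ->]] := ltilde_QbsE Hl (e := (_, H)) HH (isT : 0 < size (c :: gs))%N.
  split=> //; rewrite HE itbZ //.
  by apply/homogeneous_multilinear/hom_raw.
apply: QB_ext.
  have U1 (Phi : seq (nat * b A B) -> seq (nat * b A B) -> QB) :
      (forall s t, homb s -> homb t -> (Phi s t).1 = 0) -> (U Phi).1 = 0.
    move=> Phi0; rewrite /U (@unshuffle_map _ _ _ _ _ (fun x : QB => x.1)) //.
    rewrite (@unshuffle_in _ _ _ _ (fun e : nat * b A B => Homn e.1 e.2)
      _ (fun _ _ => 0)) //; first exact: unshuffle0.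
  rewrite /= E1 !U1 ?(scaler0, addr0) // => s t Hs Ht /=.
    by have [-> _] := nested_Q_Q H2 H1 Ht Hs; rewrite !scaler0.
  by have [-> _] := nested_Q_Q H1 H2 Hs Ht; rewrite !scaler0.
have U2 (Phi : seq (nat * b A B) -> seq (nat * b A B) -> QB)
    (Psi : seq (nat * b A B) -> seq (nat * b A B) -> funB) :
    (forall s t, homb s -> homb t -> (Phi s t).2 = Psi s t :> funB) ->
    (U Phi).2 = U' Psi :> funB.
  move=> PhiE; rewrite /U (@unshuffle_map _ _ _ _ _ (fun x : QB => bval x.2)) //.
  by apply: (@unshuffle_in _ _ _ _ (fun e : nat * b A B => Homn e.1 e.2)).
(* The sign that occurs in the value of a nested bracket. *)
pose N (a c S T : nat) : K := (-1) ^+ ((a + S) * c.+1) * (-1) ^+ ((a + S) * T).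
set Phi2 := fun s t => _; set Phi3 := fun s t => _.
have V2 : (U Phi2).2 = U' (fun s t => sg K (~~ odd e2.1 && odd (total_degree (raw s))) *:
   (N e1.1 e2.1 (total_degree (raw s)) (total_degree (raw t)) *:
    P (bracket (Y t) (ext0 (P (X s)))))) :> funB.
  apply: U2 => s t Hs Ht; have [_ E] := nested_Q_Q H1 H2 Hs Ht.
  by rewrite bval2Z E /N !scalerA.
have V3 : (U Phi3).2 = U' (fun s t =>
   sg K (odd (total_degree (raw s)) && odd (total_degree (raw t))) *:
   (sg K (~~ odd e1.1 && odd (total_degree (raw t))) *:
    (N e2.1 e1.1 (total_degree (raw t)) (total_degree (raw s)) *:
    P (bracket (X s) (ext0 (P (Y t))))))) :> funB.
  apply: U2 => s t Hs Ht; have [_ E] := nested_Q_Q H2 H1 Ht Hs.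
  by rewrite !bval2Z E /N !scalerA.
rewrite bval2D bval2Z bval2D !bval2Z.
rewrite E2 V2 V3.
rewrite !scale1r addrC /U' -!unshuffle_linear -[RHS]/(0 : funB).
rewrite -[RHS](unshuffle0 (fun e : nat * b A B => odd e.1) _ [::] [::] fs).
apply: (@unshuffle_in _ _ _ _ (fun e : nat * b A B => Homn e.1 e.2)) => // s t Hs Ht.
have HX : Homn _ (X s) := Homn_itb HF (hom_raw Hs).
have HY : Homn _ (Y t) := Homn_itb HG (hom_raw Ht).
rewrite (P_bracket_split (proj1 HX) (proj1 HY)).
rewrite (bracketC (ext0_Homn (P_Homn HX)) HY).
rewrite -[P (- _ *: _)]/(- _ *: P _) /c3 /N /sg.
move: (total_degree (raw s)) (total_degree (raw t)) => S T.
sign_cases; lin_ring K (seq B -> A)%type.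
Qed.

End JacobiIdentityQQ.

Section LinftyStructure.
Variables (K : fieldType) (A B : lmodType K).
Local Notation QB := (QB A B).
Local Notation gr := (@deg_QB K A B).

Lemma jacobiator0 (l : seq QB -> QB) es : is_ltilde l ->
  List.Forall (homogeneous gr) es -> jacobiator l es = 0.
Proof.
move=> Hl; apply: (pure_sorted_ind (R := fun es => jacobiator l es = 0))
  => {es} [s d x y t Ex Ey|s d t|s x y t Hs Exy|qs fs Hq Hf].
- by rewrite jacobiator_add // Ex Ey addr0.
- have := jacobiator_add Hl s d 0 0 t; rewrite addr0 => /esym/eqP.
  by rewrite -subr_eq0 addrK => /eqP.
- rewrite (jacobiator_swap Hl); last first.
    by move: Hs; rewrite !(List.Forall_app, List.Forall_cons_iff); tauto.
  by rewrite Exy scaler0.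
have [/eqP s2|n2] := boolP (size qs == 2).
  case: qs s2 Hq => [|e1 [|e2 []]] // _.
  case/List.Forall_cons_iff=> H1 /List.Forall_cons_iff[H2 _].
  exact: (jacobiator_QQ Hl H1 H2 Hf).
have [/andP[/eqP s3 /nilP f0]|n3] := boolP ((size qs == 3) && nilp fs).
  case: qs s3 Hq {n2} => [|e1 [|e2 [|e3 []]]] // _.
  case/List.Forall_cons_iff=> H1 /List.Forall_cons_iff[H2 /List.Forall_cons_iff[H3 _]].
  by rewrite f0; apply: (jacobiator_QQQ Hl H1 H2 H3).
apply: (unshuffle_vanish Hl (q1 := [::]) (q2 := [::])) => //.
by move: n3; rewrite negb_and /nilp -lt0n.
Qed.

Lemma Linfty_jacobi_ltilde (l : seq QB -> QB) N (x : 'I_N -> QB) (d : 'I_N -> int) :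
  is_ltilde l -> (forall i, gr (d i) (x i)) ->
  \sum_(1 <= i < N.+1) \sum_(sigma : 'S_N | is_shuffle i sigma)
    koszul K d sigma *:
      l (l (take i (permuted x sigma)) :: drop i (permuted x sigma)) = 0.
Proof.
move=> Hl Hx; pose it i := (d i, x i).
pose Psi (s t : seq 'I_N) := l (l [seq x i | i <- s] :: [seq x i | i <- t]).
have := shuffle_sumE d Psi.
have -> : unshuffle (fun k => odd `|d k|%N)
    (fun s t => if s is [::] then 0 else Psi s t) [::] [::] (enum 'I_N)
  = jacobiator l [seq it i | i <- enum 'I_N].
  rewrite /jacobiator (unshuffle_comap _ it _ [::] [::]); apply: unshuffle_eq => s t.
  by case: s => //= i s; rewrite /Psi /values -!map_comp.
rewrite jacobiator0 //; last first.
  by elim: (enum 'I_N) => [|i w IH] /=; constructor; rewrite // /homogeneous; apply: Hx.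
move=> E0; rewrite -[RHS]E0; apply: eq_bigr => i _; apply: eq_bigr => sigma _.
have E : permuted x sigma = [seq x k | k <- [seq sigma k | k <- enum 'I_N]].
  by rewrite -map_comp.
by rewrite E -map_take -map_drop.
Qed.

Lemma component_QB_proof (F : Q A B) n : component n F \in @Q_pred K A B.
Proof.
have /Q_predP[[FL F0 [N FN]] /P_mapE PF] := valP F.
apply/Q_predP; split; first exact: Homn_finite (Homn_component n FL).
by apply/P_mapE => bs; rewrite /component; case: ifP => // _; apply: PF.
Qed.

Lemma component_b_proof (f : b A B) n : component n f \in @b_pred K A B.
Proof.
have /b_predP[fL _ _] := valP f.
by apply/b_predP; apply: Homn_finite (Homn_component n fL).
Qed.

(** The component of degree d of an element of Q[1] + b; in Q it is the one of
    degree d + 1. *)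
Definition component_QB (x : QB) (d : int) : QB :=
  (if d + 1 is Posz n then MkQ (component_QB_proof x.1 n) else 0,
   if d is Posz n then Mkb (component_b_proof x.2 n) else 0).

Lemma component_QB_deg x d : gr d (component_QB x d).
Proof.
split; rewrite /component_QB /=.
  case: (d + 1) => n //=; apply/QnE; split.
    have /Q_predP[[FL _ _] _] := valP x.1; exact: Homn_component FL.
  have /Q_predP[_ /P_mapE PF] := valP x.1.
  by apply/P_mapE => bs; rewrite /component; case: ifP => // _; apply: PF.
case: d => n //=; have /b_predP[fL _ _] := valP x.2; exact: Homn_component fL.
Qed.

Lemma component_QB_shift (x : QB) (k : nat) :
  ((component_QB x (k%:Z - 1)).1 = component k x.1 :> (seq (A * B) -> A * B))
  * ((component_QB x (k%:Z - 1)).2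
     = (if k is k'.+1 then component k' x.2 else 0) :> (seq B -> A)).
Proof.
split; first by rewrite /component_QB subrK.
case: k => [|k] //.
by have -> : k.+1%:Z - 1 = k%:Z by rewrite -addn1 PoszD addrK.
Qed.

Lemma QB_sum1 I (r : seq I) (y : I -> QB) :
  Qval (\sum_(d <- r) y d).1 = \sum_(d <- r) Qval (y d).1.
Proof. exact: (big_morph (fun x : QB => Qval x.1) (fun _ _ => erefl) erefl). Qed.

Lemma QB_sum2 I (r : seq I) (y : I -> QB) :
  bval (\sum_(d <- r) y d).2 = \sum_(d <- r) bval (y d).2.
Proof. exact: (big_morph (fun x : QB => bval x.2) (fun _ _ => erefl) erefl). Qed.

(** Functions with disjoint supports that add up to zero are zero. *)
Lemma disjoint_supports (T : Type) (W : lmodType K) (I : eqType) (ds : seq I)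
    (y : I -> T -> W) (p : I -> pred T) :
  uniq ds -> (forall d d' s, p d s -> p d' s -> d = d') ->
  (forall d s, ~~ p d s -> y d s = 0) ->
  \sum_(d <- ds) y d = 0 -> forall d, d \in ds -> y d = 0.
Proof.
move=> un pinj y0 s0 d dds; apply: funext => s.
have [pds|] := boolP (p d s); last exact: y0.
have : (\sum_(d <- ds) y d) s = 0 by rewrite s0.
rewrite fct_sumE (bigD1_seq d) //= big1 ?addr0 // => d' nd'.
by apply: y0; apply: contra nd' => pd's; rewrite (pinj _ _ _ pds pd's).
Qed.

Lemma QB_is_grading : is_grading gr.
Proof.
split=> [|x|ds y un Hy s0 d dds]; first exact: deg_QB_sub.
  have [/Q_predP[[_ F0 [N FN]] _] /b_predP[_ f0 [M fM]]] := (valP x.1, valP x.2).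
  (* The lowest degree is -1, that of Q_0 in Q[1]. *)
  pose ds := [seq k%:Z - 1 | k <- iota 0 (N + M).+1].
  exists ds, (component_QB x); split; first exact: component_QB_deg.
  apply: QB_ext; rewrite ?QB_sum1 ?QB_sum2 big_map -/(index_iota 0 (N + M).+1) big_mkord.
    rewrite (eq_bigr (fun k : 'I_(N + M).+1 => component k x.1)) => [|k _].
      by apply: component_sum => // s ltNM; apply: FN; lia.
    by rewrite component_QB_shift.
  rewrite (eq_bigr (fun k : 'I_(N + M).+1 =>
    if k : nat is k'.+1 then component k' x.2 else 0)) => [|k _].
    rewrite big_ord_recl add0r; apply: component_sum => // s ltNM; apply: fM; lia.
  by rewrite component_QB_shift.
have p_inj (d1 d2 : int) (T : Type) (s : seq T) (c : int) :
  (size s)%:Z == d1 + c -> (size s)%:Z == d2 + c -> d1 = d2.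
  by move=> /eqP -> /eqP/addIr.
apply: QB_ext.
  have := @disjoint_supports _ _ _ ds (fun d => Qval (y d).1)
    (fun d s => (size s)%:Z == d + 2%:Z) un.
  apply=> // [d1 d2 s|d' s ns|].
  - exact: p_inj.
  - have [+ _] := Hy d'; case En: (d' + 1) => [n|n] /= => [/QnE[[_ F0] _]|->] //.
    by apply: F0; apply: contra ns => /eqP->; apply/eqP; lia.
  - by rewrite -QB_sum1 s0.
have := @disjoint_supports _ _ _ ds (fun d => bval (y d).2)
  (fun d s => (size s)%:Z == d + 1) un.
apply=> // [d1 d2 s|d' s ns|].
- exact: p_inj.
- have [_ +] := Hy d'; case: d' ns => n ns /= => [[_ f0]|->] //.
  by apply: f0; apply: contra ns => /eqP->; apply/eqP; lia.
- by rewrite -QB_sum2 s0.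
Qed.

Lemma ltilde_Linfty (l : seq QB -> QB) : is_ltilde l -> Linfty_algebra gr l.
Proof.
move=> Hl; split; first exact: QB_is_grading.
- exact: ltilde_multilinear Hl.
- exact: ltilde_symmetric Hl.
- move=> N x d N0 Hx.
  have := @ltilde_degree _ _ _ _ Hl [seq (d i, x i) | i <- enum 'I_N].
  rewrite size_map_enum /degrees big_map big_enum /= => H.
  have -> : permuted x 1%g = values [seq (d i, x i) | i <- enum 'I_N].
    by rewrite /values -map_comp; apply: eq_map => i; rewrite perm1.
  apply: H => //.
  by elim: (enum 'I_N) => [|i w IH] /=; constructor; rewrite // /homogeneous; apply: Hx.
by move=> N x d _; apply: Linfty_jacobi_ltilde.
Qed.

End LinftyStructure.

(** * Construction of the brackets *)

Section ParityOperators.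
Variables (K : fieldType) (U W : lmodType K).
Implicit Types f g : seq U -> W.

(** The sum of the components of odd (c = true) or even degree. *)
Definition parity_part (c : bool) f : seq U -> W :=
  fun s => if odd (size s).-1 == c then f s else 0.

(** Multiplication by (-1)^n in degree n, that is, on lists of length n + 1. *)
Definition sign_twist f : seq U -> W := fun s => (-1) ^+ (size s).-1 *: f s.

Lemma parity_part_linear c (a : K) f g :
  parity_part c (a *: f + g) = a *: parity_part c f + parity_part c g.
Proof.
apply: funext => s; rewrite fctcombE /parity_part; case: ifP => // _.
by rewrite scaler0 addr0.
Qed.

Lemma sign_twist_linear (a : K) f g :
  sign_twist (a *: f + g) = a *: sign_twist f + sign_twist g.
Proof.
apply: funext => s; rewrite fctcombE /sign_twist fctcombE; lin_ring K W.
Qed.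

Lemma parity_part_add f : 1 *: parity_part true f + parity_part false f = f.
Proof.
apply: funext => s; rewrite fctcombE scale1r /parity_part.
by case: odd; rewrite ?addr0 ?add0r.
Qed.

Lemma parity_part_finite c f : finite_multilinear f -> finite_multilinear (parity_part c f).
Proof.
move=> [fL f0 [N fN]]; split; first last.
- by exists N => s sN; rewrite /parity_part fN // if_same.
- by rewrite /parity_part f0 if_same.
move=> s t a u v; rewrite /parity_part !size_cat /=; case: ifP => _; first exact: fL.
by rewrite scaler0 addr0.
Qed.

Lemma sign_twist_finite f : finite_multilinear f -> finite_multilinear (sign_twist f).
Proof.
move=> [fL f0 [N fN]]; split; first last.
- by exists N => s sN; rewrite /sign_twist fN // scaler0.
- by rewrite /sign_twist f0 scaler0.
move=> s t a u v; rewrite /sign_twist !size_cat /= fL; lin_ring K W.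
Qed.

Lemma parity_part_Homn c n f : Homn n f -> parity_part c f = if odd n == c then f else 0.
Proof.
move=> [_ f0]; apply: funext => s; rewrite /parity_part.
have [ss|ns] := eqVneq (size s) n.+1; first by rewrite ss /=; case: ifP.
by rewrite f0 // if_same; case: ifP => // _; rewrite f0.
Qed.

Lemma sign_twist_Homn n f : Homn n f -> sign_twist f = (-1) ^+ n *: f.
Proof.
move=> [_ f0]; apply: funext => s; rewrite /sign_twist -[RHS]/(_ *: f s).
by have [->//|ns] := eqVneq (size s) n.+1; rewrite f0 // !scaler0.
Qed.

End ParityOperators.

Section Construction.
Variables (K : fieldType) (A B : lmodType K).
Local Notation QB := (QB A B).
Local Notation gr := (@deg_QB K A B).
Local Notation funV := (seq (A * B) -> A * B).
Local Notation funB := (seq B -> A).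
Local Notation fin := (@finite_multilinear K B A).
Implicit Types (F G : funV) (g h : funB) (gs hs : seq funB).

Lemma fin_multilinear gs : List.Forall fin gs -> List.Forall (@multilinear K B A) gs.
Proof. by apply: List.Forall_impl => g []. Qed.

(** The bracket of gs ++ (F :: hs), the elements of gs being moved behind F.
    An F of degree n in Q has degree n - 1 in Q[1]: the move has no sign if n is
    odd, and if n is even each g contributes the sign of its degree. Only
    parities matter, so that homogeneity is not needed. *)
Definition derived_bracket F gs hs : funB :=
  P (itb (parity_part true F) (gs ++ hs))
  + P (itb (parity_part false F) ([seq sign_twist g | g <- gs] ++ hs)).

Lemma twist_fin gs : List.Forall fin gs -> List.Forall fin [seq sign_twist g | g <- gs].
Proof.
elim: gs => [|g gs IH] /=; first by constructor.
by case/List.Forall_cons_iff=> /sign_twist_finite Hg /IH; constructor.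
Qed.

Lemma derived_bracket_finite F gs hs : finite_multilinear F ->
  List.Forall fin gs -> List.Forall fin hs -> fin (derived_bracket F gs hs).
Proof.
move=> HF Hg Hh; apply: (subspaceD (@finite_multilinear_sub K B A)); apply: P_finite;
  apply: itb_finite; try exact: parity_part_finite; apply/List.Forall_app; split=> //.
exact: twist_fin.
Qed.

Lemma derived_bracket_linear a F G gs hs : List.Forall fin gs -> List.Forall fin hs ->
  derived_bracket (a *: F + G) gs hs
  = a *: derived_bracket F gs hs + derived_bracket G gs hs.
Proof.
move=> Hg Hh; rewrite /derived_bracket !parity_part_linear !itb_linear ?P_linear.
- lin_ring K (seq B -> A)%type.
- by apply/fin_multilinear/List.Forall_app; split=> //; apply: twist_fin.
- by apply/fin_multilinear/List.Forall_app.
Qed.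

Lemma derived_bracket_linear_post a F gs s g h t : finite_multilinear F ->
  List.Forall fin gs -> List.Forall fin s -> List.Forall fin t ->
  derived_bracket F gs (s ++ (a *: g + h) :: t)
  = a *: derived_bracket F gs (s ++ g :: t) + derived_bracket F gs (s ++ h :: t).
Proof.
move=> HF Hg Hs Ht; rewrite /derived_bracket !catA.
have fL c us : List.Forall fin us -> multilinear (itb (parity_part c F) us).
  by move=> Hus; have [] := itb_finite (parity_part_finite c HF) Hus.
have tL := fin_multilinear Ht.
have L1 : multilinear (itb (parity_part true F) (gs ++ s)).
  by apply: fL; apply/List.Forall_app.
have L2 : multilinear (itb (parity_part false F) ([seq sign_twist g | g <- gs] ++ s)).
  by apply: fL; apply/List.Forall_app; split=> //; apply: twist_fin.
rewrite !itb_linearr // !P_linear; lin_ring K (seq B -> A)%type.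
Qed.

Lemma derived_bracket_linear_pre a F s g h t hs : finite_multilinear F ->
  List.Forall fin s -> List.Forall fin t -> List.Forall fin hs ->
  derived_bracket F (s ++ (a *: g + h) :: t) hs
  = a *: derived_bracket F (s ++ g :: t) hs + derived_bracket F (s ++ h :: t) hs.
Proof.
move=> HF Hs Ht Hh; rewrite /derived_bracket !map_cat /= -!catA /= sign_twist_linear.
have fL c us : List.Forall fin us -> multilinear (itb (parity_part c F) us).
  by move=> Hus; have [] := itb_finite (parity_part_finite c HF) Hus.
have H1 : List.Forall fin (t ++ hs) by apply/List.Forall_app.
have H2 : List.Forall fin ([seq sign_twist g | g <- t] ++ hs).
  by apply/List.Forall_app; split=> //; apply: twist_fin.
have M1 := fin_multilinear H1; have M2 := fin_multilinear H2.
have L1 := fL true _ Hs; have L2 := fL false _ (twist_fin Hs).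
rewrite !itb_linearr // !P_linear; lin_ring K (seq B -> A)%type.
Qed.

Lemma derived_bracket0 gs hs : List.Forall fin gs -> List.Forall fin hs ->
  derived_bracket 0 gs hs = 0.
Proof.
move=> Hg Hh; have := derived_bracket_linear (-1) 0 0 Hg Hh.
by rewrite !scaleN1r oppr0 addr0 addNr.
Qed.

Lemma derived_bracket_post0 F gs s t : finite_multilinear F ->
  List.Forall fin gs -> List.Forall fin s -> List.Forall fin t ->
  derived_bracket F gs (s ++ 0 :: t) = 0.
Proof.
move=> HF Hg Hs Ht; have := derived_bracket_linear_post (-1) 0 0 HF Hg Hs Ht.
by rewrite !scaleN1r oppr0 addr0 addNr.
Qed.

Lemma derived_bracket_nil F hs : List.Forall fin hs ->
  derived_bracket F [::] hs = P (itb F hs).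
Proof.
move=> /fin_multilinear Hh; rewrite /derived_bracket /= -{3}(parity_part_add F).
by rewrite itb_linear // scale1r.
Qed.

Lemma derived_bracket_Homn n F (gs hs : seq (nat * funB)) : Homn n F ->
  homogeneous_list gs -> homogeneous_list hs ->
  derived_bracket F [seq e.2 | e <- gs] [seq e.2 | e <- hs]
  = (-1) ^+ (n.+1 * total_degree gs) *: P (itb F [seq e.2 | e <- gs ++ hs]).
Proof.
move=> HF Hg Hh; rewrite /derived_bracket !(parity_part_Homn _ HF) !map_cat.
have itb0 us : List.Forall (@multilinear K B A) us -> itb (0 : funV) us = 0.
  by move=> Hus; have := itbZ 0 (0 : funV) Hus; rewrite !scale0r.
have P0 : P (0 : funV) = 0 by [].
have twistE : [seq sign_twist g | g <- [seq e.2 | e <- gs]]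
   = [seq (-1) ^+ e.1 *: e.2 | e <- gs].
  elim: gs Hg => //= e gs IH /List.Forall_cons_iff[He Hgs].
  by rewrite IH // (sign_twist_Homn He).
have Hh' := homogeneous_multilinear Hh; have Hg' := homogeneous_multilinear Hg.
have scaled u : multilinear u ->
   itb u ([seq (-1) ^+ e.1 *: e.2 | e <- gs] ++ [seq e.2 | e <- hs])
   = (-1) ^+ (total_degree gs) *: itb u ([seq e.2 | e <- gs] ++ [seq e.2 | e <- hs]).
  elim: (gs) (Hg) u => [|e gs' IH] /= He u uL; first by rewrite scale1r.
  case/List.Forall_cons_iff: He => -[eL _] Hgs'.
  have eZ : bracket u (ext0 ((-1) ^+ e.1 *: e.2)) = (-1) ^+ e.1 *: bracket u (ext0 e.2).
    by rewrite -[_ *: e.2]addr0 ext0_comb bracket_linearr // bracket0r // addr0.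
  have HL : List.Forall (@multilinear K B A)
      ([seq e.2 | e <- gs'] ++ [seq e.2 | e <- hs]).
    by apply/List.Forall_app; split=> //; apply: homogeneous_multilinear.
  have bL : multilinear (bracket u (ext0 e.2)).
    by apply: bracket_multilinear => //; apply: ext0_multilinear.
  have zL : multilinear ((-1) ^+ e.1 *: bracket u (ext0 e.2)).
    exact: multilinear_scale.
  by rewrite eZ IH // itbZ // scalerA -exprD addnC.
have HL : List.Forall (@multilinear K B A) ([seq e.2 | e <- gs] ++ [seq e.2 | e <- hs]).
  by apply/List.Forall_app.
have FL := proj1 HF.
have TL : List.Forall (@multilinear K B A)
    ([seq (-1) ^+ e.1 *: e.2 | e <- gs] ++ [seq e.2 | e <- hs]).
  apply/List.Forall_app; split=> //; elim: (gs) (Hg) => [|e us IH] /= Hu.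
    by constructor.
  case/List.Forall_cons_iff: Hu => -[eL _] /IH; constructor=> //.
  exact: multilinear_scale.
rewrite twistE; case on : (odd n) => /=.
  rewrite [X in _ + P X]itb0 // P0 addr0.
  by rewrite -signr_odd oddM /= on /= scale1r.
rewrite itb0 // P0 add0r scaled // -[P (_ *: _)]/(_ *: P _).
by congr (_ *: _); rewrite -[RHS]signr_odd oddM /= on signr_odd.
Qed.

(** The component of the brackets with values in b: the elements of pre precede
    those of xs; each entry of xs in turn contributes its component in Q. *)
Fixpoint b_bracket (pre : seq funB) (xs : seq QB) : funB :=
  if xs is x :: xs' then
    derived_bracket x.1 pre [seq bval y.2 | y <- xs'] + b_bracket (rcons pre (bval x.2)) xs'
  else 0.

Lemma fin_bvals (xs : seq QB) : List.Forall fin [seq bval y.2 | y <- xs].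
Proof.
elim: xs => [|x xs IH] /=; constructor=> //.
exact/b_predP/(valP x.2).
Qed.

Lemma fin_Qval (F : Q A B) : finite_multilinear (F : funV).
Proof. by have /Q_predP[] := valP F. Qed.

Lemma fin_bval (f : b A B) : fin f.
Proof. by have /b_predP := valP f. Qed.

Lemma b_bracket_finite pre xs : List.Forall fin pre -> fin (b_bracket pre xs).
Proof.
elim: xs pre => [|x xs IH] pre Hpre /=.
  exact: subspace0 (@finite_multilinear_sub K B A).
apply: (subspaceD (@finite_multilinear_sub K B A)).
  apply: derived_bracket_finite => //; [exact: fin_Qval|exact: fin_bvals].
by apply: IH; apply: Forall_rcons => //; apply: fin_bval.
Qed.

Lemma b_bracket_linear_pre a p g h q xs : List.Forall fin p -> List.Forall fin q ->
  fin g -> fin h ->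
  b_bracket (p ++ (a *: g + h) :: q) xs
  = a *: b_bracket (p ++ g :: q) xs + b_bracket (p ++ h :: q) xs.
Proof.
move=> Hp + Hg Hh; elim: xs q => [|x xs IH] q Hq /=; first by rewrite scaler0 addr0.
rewrite derived_bracket_linear_pre //; [|exact: fin_Qval|exact: fin_bvals].
rewrite !rcons_cat /= IH; last by apply: Forall_rcons => //; apply: fin_bval.
lin_ring K (seq B -> A)%type.
Qed.

Lemma b_bracket_linear pre s a (u v : QB) t : List.Forall fin pre ->
  b_bracket pre (s ++ (a *: u + v) :: t)
  = a *: b_bracket pre (s ++ u :: t) + b_bracket pre (s ++ v :: t).
Proof.
elim: s pre => [|x s IH] pre Hpre /=.
  rewrite derived_bracket_linear //; last exact: fin_bvals.
  rewrite -!cats1 b_bracket_linear_pre //; try exact: fin_bval.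
  lin_ring K (seq B -> A)%type.
rewrite IH; last by apply: Forall_rcons => //; apply: fin_bval.
rewrite !map_cat /=.
rewrite derived_bracket_linear_post //; try exact: fin_bvals; last exact: fin_Qval.
lin_ring K (seq B -> A)%type.
Qed.

Lemma b_bracket_pre0 p q xs : List.Forall fin p -> List.Forall fin q ->
  b_bracket (p ++ 0 :: q) xs = 0.
Proof.
move=> Hp Hq; have f0 : fin 0 := subspace0 (@finite_multilinear_sub K B A).
have := b_bracket_linear_pre (-1) xs Hp Hq f0 f0.
by rewrite !scaleN1r oppr0 addr0 addNr.
Qed.

End Construction.

Section Existence.
Variables (K : fieldType) (A B : lmodType K).
Local Notation QB := (QB A B).
Local Notation gr := (@deg_QB K A B).
Local Notation funV := (seq (A * B) -> A * B).
Local Notation funB := (seq B -> A).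
Local Notation fin := (@finite_multilinear K B A).

Lemma Q_bracket_proof (F G : Q A B) : bracket (sign_twist F) G \in @Q_pred K A B.
Proof.
have [[HF PF] [HG PG]] := (Q_predP _ (valP F), Q_predP _ (valP G)).
apply/Q_predP; split; first by apply: bracket_finite => //; apply: sign_twist_finite.
apply: P_bracket => //; apply/P_mapE => bs; rewrite /sign_twist.
by move/P_mapE: PF => /(_ bs) E; rewrite -[LHS]/(_ *: (Qval F _).1) E scaler0.
Qed.

(** The binary bracket on Q[1], with its sign (-1)^n for F of degree n. *)
Definition Q_bracket (F G : Q A B) : Q A B := MkQ (Q_bracket_proof F G).

Lemma b_bracket_proof (xs : seq QB) : b_bracket [::] xs \in @b_pred K A B.
Proof. by apply/b_predP; apply: b_bracket_finite. Qed.

(** The brackets of the L-infinity algebra on arbitrary, not necessarily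
    homogeneous, lists of elements. *)
Definition ltilde (xs : seq QB) : QB :=
  (if xs is [:: x; y] then Q_bracket x.1 y.1 else 0, Mkb (b_bracket_proof xs)).

Lemma ltilde_val2 xs : bval (ltilde xs).2 = b_bracket [::] xs.
Proof. by []. Qed.

Lemma Q_bracket_linearl a (F G H : Q A B) :
  Q_bracket (a *: F + G) H = a *: Q_bracket F H + Q_bracket G H.
Proof.
have [HL _ _] := fin_Qval H; apply: val_inj.
rewrite -[RHS]/(a *: bracket (sign_twist F) H + bracket (sign_twist G) H).
rewrite -[LHS]/(bracket (sign_twist (a *: (F : funV) + G)) H).
by rewrite sign_twist_linear bracket_linearl.
Qed.

Lemma Q_bracket_linearr a (F G H : Q A B) :
  Q_bracket H (a *: F + G) = a *: Q_bracket H F + Q_bracket H G.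
Proof.
have [HL _ _] := sign_twist_finite (fin_Qval H); apply: val_inj.
rewrite -[RHS]/(a *: bracket (sign_twist H) F + bracket (sign_twist H) G).
rewrite -[LHS]/(bracket (sign_twist H) (a *: (F : funV) + G)).
by rewrite bracket_linearr.
Qed.

Lemma ltilde_is_multilinear : multilinear ltilde.
Proof.
move=> s t a u v; apply: QB_ext; last first.
  by rewrite [LHS]b_bracket_linear.
apply: congr1; rewrite -[RHS]/(a *: (ltilde (s ++ u :: t)).1 + (ltilde (s ++ v :: t)).1).
case: s t => [|x [|y [|z s]]] [|x' [|y' t]] /=; rewrite ?scaler0 ?addr0 //.
  exact: Q_bracket_linearl.
exact: Q_bracket_linearr.
Qed.

Lemma Q_bracket0l G : Q_bracket 0 G = 0.
Proof.
have := Q_bracket_linearl (-1) 0 0 G.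
by rewrite !scaleN1r oppr0 addr0 addNr.
Qed.

Lemma Q_bracket0r F : Q_bracket F 0 = 0.
Proof.
have := Q_bracket_linearr (-1) 0 0 F.
by rewrite !scaleN1r oppr0 addr0 addNr.
Qed.

(** The entry of degree d of a homogeneous list, seen in b. *)
Definition b_item (e : int * QB) : nat * funB := (`|e.1|%N, bval e.2.2).

Lemma hom_b_item e : homogeneous gr e -> Homn (b_item e).1 (b_item e).2.
Proof.
case: e => -[n|n] x [_ /= H] //; rewrite H.
exact: subspace0 (@Homn_submod K B A n.+1).
Qed.

Lemma hom_b_items es : List.Forall (homogeneous gr) es ->
  homogeneous_list (map b_item es).
Proof.
elim: es => [|e es IH] /=; first by constructor.
by case/List.Forall_cons_iff=> /hom_b_item He /IH; constructor.
Qed.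

Lemma hom_Q_item (e : int * QB) : homogeneous gr e -> Homn (absz (e.1 + 1)) (Qval e.2.1).
Proof.
move=> [+ _]; case: (e.1 + 1) => n /= => [/QnE[]//|->].
exact: subspace0 (@Homn_submod K _ _ n.+1).
Qed.

(** On homogeneous lists the sign of moving the entries of pre is explicit. *)
Fixpoint hom_bracket (pre : seq (nat * funB)) (es : seq (int * QB)) : funB :=
  if es is e :: es' then
    (-1) ^+ (`|e.1| * total_degree pre) *:
      P (itb (Qval e.2.1) [seq c.2 | c <- pre ++ map b_item es'])
    + hom_bracket (rcons pre (b_item e)) es'
  else 0.

Lemma hom_bracketE pre es : homogeneous_list pre -> List.Forall (homogeneous gr) es ->
  b_bracket [seq c.2 | c <- pre] (values es) = hom_bracket pre es.
Proof.
elim: es pre => [|e es IH] pre Hp //= /List.Forall_cons_iff[He Hes].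
have -> : rcons [seq c.2 | c <- pre] (bval e.2.2) = [seq c.2 | c <- rcons pre (b_item e)].
  by rewrite map_rcons.
rewrite IH //; last by apply: Forall_rcons => //; apply: hom_b_item.
congr (_ + _).
have -> : [seq bval y.2 | y <- [seq e.2 | e <- es]] = [seq c.2 | c <- map b_item es].
  by rewrite -!map_comp.
rewrite (derived_bracket_Homn (hom_Q_item He) Hp (hom_b_items Hes)).
congr (_ *: _); rewrite -signr_odd -[RHS]signr_odd !oddM; congr (_ ^+ (_ && _)).
have E : odd (absz (e.1 + 1)).+1 = odd (absz e.1) by lia.
by rewrite E.
Qed.

Lemma hom_bracket_swap_pre p a c q es : homogeneous_list (p ++ a :: c :: q) ->
  List.Forall (homogeneous gr) es ->
  hom_bracket (p ++ a :: c :: q) es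
  = (-1) ^+ (a.1 * c.1) *: hom_bracket (p ++ c :: a :: q) es.
Proof.
elim: es q => [|e es IH] q Hp /=; first by rewrite scaler0.
case/List.Forall_cons_iff=> He Hes; rewrite !rcons_cat /= IH //; last first.
  rewrite -2!rcons_cons -rcons_cat; apply: Forall_rcons => //; exact: hom_b_item.
have [Hp1 [Ha [Hc Hq]]] : homogeneous_list p /\ Homn a.1 a.2 /\ Homn c.1 c.2 /\
    homogeneous_list q.
  by move: Hp; rewrite /homogeneous_list !(List.Forall_app, List.Forall_cons_iff); tauto.
have Hqe : homogeneous_list (q ++ map b_item es).
  by apply/List.Forall_app; split=> //; apply: hom_b_items.
have := itb_swap (hom_Q_item He) Hp1 Ha Hc Hqe.
rewrite !map_cat /= -!catA /= => ->.
have -> : total_degree (p ++ a :: c :: q) = total_degree (p ++ c :: a :: q).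
  by rewrite /total_degree !map_cat !sumn_cat /=; lia.
rewrite -[P (_ *: _)]/(_ *: P _); lin_ring K (seq B -> A)%type.
Qed.

Lemma hom_bracket_swap pre s x y t : homogeneous_list pre ->
  List.Forall (homogeneous gr) (s ++ x :: y :: t) ->
  hom_bracket pre (s ++ x :: y :: t)
  = sg K (item_parity x && item_parity y) *: hom_bracket pre (s ++ y :: x :: t).
Proof.
elim: s pre => [|e s IH] pre Hp /=.
  case/List.Forall_cons_iff=> Hx /List.Forall_cons_iff[Hy Ht].
  have Hbx := hom_b_item Hx; have Hby := hom_b_item Hy.
  rewrite -!cats1 -!catA /= hom_bracket_swap_pre //; last first.
    by apply/List.Forall_app; split=> //; constructor=> //; constructor=> //; constructor.
  rewrite /total_degree !map_cat !sumn_cat /= /sg /item_parity.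
  rewrite !addn0; sign_cases; lin_ring K (seq B -> A)%type.
move=> /List.Forall_cons_iff[He Hs].
rewrite IH //; last by apply: Forall_rcons => //; apply: hom_b_item.
have [Hs1 [Hx [Hy Ht]]] : List.Forall (homogeneous gr) s /\ homogeneous gr x /\
    homogeneous gr y /\ List.Forall (homogeneous gr) t.
  by move: Hs; rewrite !(List.Forall_app, List.Forall_cons_iff); tauto.
have Hps : homogeneous_list (pre ++ map b_item s).
  by apply/List.Forall_app; split=> //; apply: hom_b_items.
have := itb_swap (hom_Q_item He) Hps (hom_b_item Hx) (hom_b_item Hy) (hom_b_items Ht).
rewrite !map_cat /= -!catA => ->.
rewrite -[P (_ *: _)]/(_ *: P _).
have -> : (-1) ^+ (`|x.1| * `|y.1|) = sg K (item_parity x && item_parity y).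
  by rewrite /sg -signr_odd oddM.
lin_ring K (seq B -> A)%type.
Qed.

Lemma ltilde_is_symmetric : graded_symmetric gr ltilde.
Proof.
apply: swap_graded_symmetric => s x y t Hs; apply: QB_ext; last first.
  rewrite -[RHS]/(sg K _ *: bval (ltilde _).2) !ltilde_val2.
  have := hom_bracket_swap (List.Forall_nil _) Hs.
  rewrite -!(hom_bracketE (pre := [::])) //; try by constructor.
  by move: Hs; rewrite !(List.Forall_app, List.Forall_cons_iff); tauto.
rewrite -[RHS]/(sg K _ *: Qval (ltilde _).1).
case: s t Hs => [|e [|e' s]] [|e'' t] /=; rewrite ?scaler0 //.
case/List.Forall_cons_iff=> Hx /List.Forall_cons_iff[Hy _].
have HX := hom_Q_item Hx; have HY := hom_Q_item Hy.
rewrite /= (sign_twist_Homn HX) (sign_twist_Homn HY).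
  rewrite (bracketZl _ _ (proj1 HY)) (bracketZl _ _ (proj1 HX)) (bracketC HX HY).
  have px (e : int * QB) : item_parity e = ~~ odd (absz (e.1 + 1)).
    by rewrite /item_parity; lia.
  by rewrite /sg !px; sign_cases; lin_ring K (seq (A * B) -> A * B)%type.
- by case: s => [|? s] /=; rewrite scaler0.
- by case: s => [|? s] /=; rewrite scaler0.
Qed.

Lemma b_bracket_no_Q pre (gs : seq (b A B)) : List.Forall fin pre ->
  b_bracket pre (map (@in2 K A B) gs) = 0.
Proof.
elim: gs pre => [|g gs IH] pre Hp //=.
rewrite IH; last by apply: Forall_rcons => //; apply: fin_bval.
by rewrite addr0 derived_bracket0 //; apply: fin_bvals.
Qed.

(** An element of Q or of b, as an element of Q[1] + b. *)
Definition pure (t : Q A B + b A B) : QB :=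
  match t with inl F => in1 F | inr f => in2 f end.

Definition is_Q (t : Q A B + b A B) : bool := if t is inl _ then true else false.

(** The component in b vanishes unless exactly one entry lies in Q: with two of
    them, the component in b of one is a zero entry of the bracket formed with
    the other. *)
Lemma b_bracket_many_Q pre (ts : seq (Q A B + b A B)) : List.Forall fin pre ->
  count is_Q ts != 1 -> b_bracket pre (map pure ts) = 0.
Proof.
elim: ts pre => [|[F|f] ts IH] pre Hp //= nQ; last first.
  rewrite IH ?addr0 ?derived_bracket0 //; first exact: fin_bvals.
  by apply: Forall_rcons => //; apply: fin_bval.
rewrite -cats1 b_bracket_pre0 // addr0.
have : has is_Q ts by rewrite has_count lt0n; apply: contra nQ => /eqP->.
move=> {IH nQ} hasQ; have [us [G [vs ->]]] : exists us G vs, ts = us ++ inl G :: vs.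
  elim: ts hasQ => //= -[G|f] ts IH /=; first by exists [::], G, ts.
  by case/IH => us [G [vs ->]]; exists (inr f :: us), G, vs.
rewrite !map_cat /= derived_bracket_post0 //; try exact: fin_bvals.
exact: fin_Qval.
Qed.

Lemma ltilde_is_ltilde : is_ltilde ltilde.
Proof.
split; [exact: ltilde_is_multilinear|exact: ltilde_is_symmetric|..].
- move=> n m F G HF HG; have [[HF' _] _] := ((QnE n F).1 HF, tt); split.
    rewrite -[LHS]/(bracket (sign_twist F) G) (sign_twist_Homn HF').
    by rewrite bracketZl //; have [] := fin_Qval G.
  by apply: val_inj; apply: (b_bracket_many_Q (ts := [:: inl F; inl G])).
- move=> n F fs HF fs0; split.
    case: fs fs0 => [|f [|g fs]] //= _; exact: Q_bracket0r.
  rewrite ltilde_val2 /= b_bracket_no_Q; last first.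
    by constructor; [exact: (fin_bval 0)|constructor].
  rewrite addr0 derived_bracket_nil; last exact: fin_bvals.
  rewrite -map_comp; congr (P _).
  by rewrite /iter_bracket /itb; elim: (fs) (Qval F) => //= f gs IH H; rewrite -IH.
move=> ts /= ts0 n2 n1; apply: QB_ext; last first.
  rewrite ltilde_val2; have [q1|] := eqVneq (count is_Q ts) 1%N; last exact: b_bracket_many_Q.
  have ts1 : size ts = 1%N.
    by move: n1; rewrite -/is_Q q1 /=; case: (ts) ts0 => [|? []].
  case: ts ts1 q1 {ts0 n2 n1} => [|[F|f] []] //= _ _.
  rewrite addr0 derived_bracket_nil //.
  by have /Q_predP[] := valP F.
congr (Qval _); case: ts ts0 n2 n1 => [|t1 [|t2 []]] //= _.
by case: t1 t2 => [F1|f1] [F2|f2] //= _ _; rewrite ?Q_bracket0l ?Q_bracket0r.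
Qed.

End Existence.

Theorem theorem7p5 (K : fieldType) (charK : [pchar K] =i pred0)
    (A B : lmodType K) :
  (exists l : seq (QB A B) -> QB A B, is_ltilde l) /\
  (forall l : seq (QB A B) -> QB A B, is_ltilde l ->
     Linfty_algebra (@deg_QB K A B) l).
Proof.
split; first by exists (@ltilde K A B); apply: ltilde_is_ltilde.
exact: ltilde_Linfty.
Qed.
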